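(* Let $B_j$, $j\in\mathbb N$, be zero-mean random processes on $[0,1]$ whose covariance functions are the Korobov kernels $\mathcal K_{\alpha_j,\beta_j,\sigma_j}$ with $\alpha_j>0$, $\beta_j>0$, $\sigma_j>1$, and let $\mathbb B_d$, $d\in\mathbb N$, be the associated additive random fields with average case approximation complexity $n^{\mathbb B_d}(\varepsilon)$. Suppose that, as $j\to\infty$, $$\beta_j\sim c\,j^{-\tau},\qquad \alpha_j/\beta_j\to r,\qquad \sigma_j\to\infty,$$ with $c>0$, $\tau<1$, and $0\leqslant r<\infty$. Let $\varepsilon_0=(1+r/2)^{-1/2}$. Then $$n^{\mathbb B_d}(\varepsilon)\sim 2\,Q(\varepsilon)\cdot d,\qquad d\to\infty,\qquad\text{for every } \varepsilon\in(0,\varepsilon_0),$$ where, for $\varepsilon\in(0,\varepsilon_0)$, $$Q(\varepsilon)=\begin{cases}\bigl(1-(\varepsilon/\varepsilon_0)^2\bigr)^{\frac{1}{1-\tau}}, & \text{if } \tau\in[0,1),\\[4pt] 1-(\varepsilon/\varepsilon_0)^{\frac{2}{1-\tau}}, & \text{if } \tau<0.\end{cases}$$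
   Context: $\mathbb N=\{1,2,\dots\}$; $a_d\sim b_d$ means $a_d/b_d\to1$. For $\alpha>0$, $\beta>0$, $\sigma>1$ the Korobov kernel is $\mathcal K_{\alpha,\beta,\sigma}(t,s)=\alpha+2\beta\sum_{k=1}^\infty k^{-\sigma}\cos(2\pi k(t-s))$, $t,s\in[0,1]$. For each $d\in\mathbb N$, $\mathbb B_d(t)$, $t\in[0,1]^d$, is a zero-mean random field (a random element of $L_2([0,1]^d)$) with covariance function $\mathcal K^{\mathbb B_d}(t,s)=\sum_{j=1}^d\mathcal K_{\alpha_j,\beta_j,\sigma_j}(t_j,s_j)$, where $t=(t_1,\dots,t_d)$, $s=(s_1,\dots,s_d)$. Approximation complexity. Let $(\cdot,\cdot)_{2,d}$, $\|\cdot\|_{2,d}$ be the inner product and norm of $L_2([0,1]^d)$. For $n\in\mathbb N$ let $\mathcal A_n^{\mathbb B_d}=\{\sum_{m=1}^n(\mathbb B_d,\psi_m)_{2,d}\,\psi_m:\ \psi_m\in L_2([0,1]^d)\}$ and $e^{\mathbb B_d}(n)=\inf\{(\mathbb E\|\mathbb B_d-\widetilde Y\|_{2,d}^2)^{1/2}:\ \widetilde Y\in\mathcal A_n^{\mathbb B_d}\}$; let $e^{\mathbb B_d}(0)=(\mathbb E\|\mathbb B_d\|_{2,d}^2)^{1/2}$. For $\varepsilon\in(0,1)$, $n^{\mathbb B_d}(\varepsilon)=\min\{n\in\mathbb N:\ e^{\mathbb B_d}(n)\leqslant\varepsilon\,e^{\mathbb B_d}(0)\}$. *)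

(* Defs.v *)
From HB Require Import structures.
From mathcomp Require Import all_boot all_order all_algebra.
From mathcomp Require Import all_classical all_reals all_analysis.

Set Implicit Arguments.
Unset Strict Implicit.
Unset Printing Implicit Defensive.

Import Order.TTheory GRing.Theory Num.Theory.
Import numFieldNormedType.Exports.

Local Open Scope classical_set_scope.
Local Open Scope ring_scope.

Section lebesgue_cube.
Context {R : realType}.
Local Notation RT := (measurableTypeR R).

Definition lebesgue_unit : set RT -> \bar R :=
  mrestr lebesgue_measure (measurable_itv (`[0, 1]%R : interval R)).

HB.instance Definition _ := Measure.on lebesgue_unit.

Let lebesgue_unit_setT : lebesgue_unit setT = 1%E.
Proof.
rewrite /lebesgue_unit /mrestr setTI.
by rewrite lebesgue_measure_itv/= lte_fin ltr01 oppr0 adde0.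
Qed.

HB.instance Definition _ :=
  Measure_isProbability.Build _ _ _ lebesgue_unit lebesgue_unit_setT.

Definition tcons d (p : RT * d.-tuple RT) : d.+1.-tuple RT :=
  [tuple of p.1 :: p.2].

Let measurable_tcons d : measurable_fun setT (@tcons d).
Proof. exact: measurable_cons. Qed.

HB.instance Definition _ d :=
  isMeasurableFun.Build _ _ _ _ (@tcons d) (@measurable_tcons d).

Definition cube d : set (d.-tuple RT) :=
  [set t | forall i, tnth t i \in `[0, 1]%R].

(* The library has no n-fold product measure: Lebesgue measure on [0,1]^d is
   built by recursion on d, as a Borel probability measure on R^d concentrated
   on the cube. Its values on boxes are given by lebesgue_cube_box below. *)
Fixpoint lebesgue_cube d : probability (d.-tuple RT) R :=
  if d is d'.+1 then
    distribution (lebesgue_unit \x lebesgue_cube d')%E (@tcons d')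
  else dirac [tuple].

Lemma lebesgue_cube_box d (A : 'I_d -> set RT) :
    (forall i, measurable (A i)) ->
  lebesgue_cube d [set t | forall i, A i (tnth t i)] =
  (\prod_(i < d) lebesgue_measure (A i `&` `[0%R, 1%R]))%E.
Proof.
elim: d A => [|d IH] A mA /=.
  by rewrite big_ord0 diracE mem_set//; case.
rewrite big_ord_recl -IH//.
set B := [set t | forall i, A (lift ord0 i) (tnth t i)].
have mB : measurable B.
  have -> : B = \bigcap_(i in setT) ((@tnth d RT)^~ i @^-1` A (lift ord0 i)).
    by apply/seteqP; split => [t Bt i _|t Bt i]; [exact: Bt | exact: (Bt i)].
  apply: fin_bigcap_measurable => // i _.
  by rewrite -[X in measurable X]setTI; exact: measurable_tnth.
rewrite /distribution /pushforward.
rewrite (_ : _ @^-1` _ = A ord0 `*` B); first exact: product_measure1E.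
apply/seteqP; split => [[x t] /= h|[x t] [/= hx ht] i].
  split; first exact: (h ord0).
  by move=> i; have := h (lift ord0 i); rewrite tnthS.
by case: (unliftP ord0 i) => [j ->|->]//; rewrite tnthS; exact: ht.
Qed.

End lebesgue_cube.
Arguments cube {R} d.
Arguments lebesgue_cube {R} d.

Definition asymp_equiv {R : realType} (u v : R^nat) :=
  (u n / v n) @[n --> \oo] --> (1 : R).

Definition korobov {R : realType} (alpha beta sigma t s : R) : R :=
  alpha + 2 * beta *
    limn (series (fun k : nat => (k.+1%:R : R) `^ (- sigma) *
                                 cos (2 * pi * k.+1%:R * (t - s)))).

Section processes.
Context {R : realType} {disp : measure_display} {Omega : measurableType disp}.
Variable P : probability Omega R.

Definition zero_mean_process {I : Type} (D : set I) (X : I -> Omega -> R) :=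
  forall t, D t -> X t \in Lfun P 2%:E /\ ('E_P[X t] = 0)%E.

(* K may be extended-real valued, like the covariance of the library. *)
Definition has_covariance_function {I : Type} (D : set I) (X : I -> Omega -> R)
    (K : I -> I -> \bar R) :=
  forall t s, D t -> D s -> covariance P (X t) (X s) = K t s.

Variable d : nat.
Local Notation point := (d.-tuple (measurableTypeR R)).
Local Notation mu := (@lebesgue_cube R d).
Implicit Types (X Y : point -> Omega -> R) (f g : point -> R).

(* A random element of L_2([0,1]^d) is represented by a jointly measurable
   field whose paths are almost surely square integrable. *)
Definition random_element_L2 X :=
  measurable_fun ([set: Omega] `*` cube d) (fun p => X p.2 p.1) /\
  {ae P, forall w, (\int[mu]_(t in cube d) (X t w ^+ 2)%:E < +oo)%E}.

Definition zero_mean_random_field X :=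
  random_element_L2 X /\ zero_mean_process (cube d) X.

Definition dotL2 f g : R := \int[mu]_(t in cube d) (f t * g t).

Definition sqnormL2 f : \bar R := (\int[mu]_(t in cube d) (f t ^+ 2)%:E)%E.

Definition rms_norm X : \bar R :=
  sqrte (\int[P]_w sqnormL2 (fun t => X t w))%E.

Definition approximants X (n : nat) : set (point -> Omega -> R) :=
  [set Y | exists psi : 'I_n -> point -> R,
     (forall m, psi m \in Lfun mu 2%:E) /\
     Y = (fun t w => \sum_(m < n) dotL2 (fun u => X u w) (psi m) * psi m t)].

Definition approx_error X (n : nat) : \bar R :=
  if n is 0 then rms_norm X
  else ereal_inf [set rms_norm (fun t w => X t w - Y t w) |
                  Y in approximants X n].

(* The minimum over n >= 1; the value is 0 if no such n exists. *)
Definition approx_complexity X (eps : R) : nat :=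
  let ok n := (0 < n)%N /\ (approx_error X n <= eps%:E * approx_error X 0)%E in
  xget 0%N [set n | ok n /\ forall m, ok m -> (n <= m)%N].

End processes.

(* Processes and fields are indexed from 1, so coordinate i : 'I_d of a point
   of the cube is associated with the process of index i.+1. *)
Definition additive_covariance {R : realType}
    (K : nat -> R -> R -> \bar R) d (t s : d.-tuple (measurableTypeR R)) :
    \bar R :=
  (\sum_(i < d) K i.+1 (tnth t i) (tnth s i))%E.

Definition eps0 {R : realType} (r : R) : R := (1 + r / 2) `^ (- 2^-1).

Definition Q {R : realType} (r tau eps : R) : R :=
  if 0 <= tau then (1 - (eps / eps0 r) ^+ 2) `^ (1 - tau)^-1
  else 1 - (eps / eps0 r) `^ (2 / (1 - tau)).

(* Main.v *)
Require Import Defs.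
From mathcomp Require Import all_boot all_order all_algebra.
From mathcomp Require Import all_classical all_reals all_analysis.
From mathcomp Require Import measurable_realfun ring lra.

Set Implicit Arguments.
Unset Strict Implicit.
Unset Printing Implicit Defensive.

Import Order.TTheory GRing.Theory Num.Theory.
Import numFieldNormedType.Exports.

Local Open Scope classical_set_scope.
Local Open Scope ring_scope.

(** Why the theorem is true.

    On the cube, the constant function and the functions sqrt 2 cos(2 pi k t_j),
    sqrt 2 sin(2 pi k t_j) are orthonormal in L_2 and diagonalize the covariance
    of the additive field: the constant carries the sum of the alpha_j, and both
    functions of index (j, k) carry beta_j k^(- sigma_j). The best
    approximation with n terms leaves the sum of all but the n largest
    eigenvalues. As sigma_j tends to infinity, zeta(sigma_j) tends to 1, so the
    frequencies k >= 2 carry a negligible share of the variance, and the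
    constant costs a single term. Hence n is, up to o(d), twice the least number
    of coordinates j <= d whose omission leaves at most the fraction
    q = (eps / eps_0)^2 of the sum of the beta_j. As beta_j is close to
    c j^(- tau), the coordinates to keep are the first ones if tau >= 0 and the
    last ones if tau < 0; the sum of the first kappa d of the beta_j is about
    kappa^(1 - tau) times the sum of all of them, and solving for kappa gives Q.

    The spectral theorem is avoided. All that is used of the covariance is the
    inequality E (X, g)^2 >= sum_i lambda_i (phi_i, g)^2 for the constant and the
    functions with k = 1 ([variance_coef_ge]), which holds because the covariance
    minus sum_i lambda_i phi_i(t) phi_i(s) is a uniform limit of sums of
    products h(t) h(s) ([cube_kernel_approx]). Projecting on a set S of the
    phi_i leaves at most the total variance minus the sum of lambda_i over S
    ([residual_le]). Conversely, for any n functions psi_m, Bessel's inequality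
    and the self-adjointness of f |-> sum_m (f, psi_m) psi_m reduce the error to
    a statement on a matrix of rank at most n ([low_rank_defect]), which yields
    the bound sum_i u_i - theta n whenever 0 <= u_i <= min(lambda_i, theta)
    ([residual_ge]). This is the dual form of the sum of the smallest
    eigenvalues, and it does not require the eigenvalues to be sorted. Both
    bounds together control the approximation complexity for each fixed d
    ([complexity_bounds]).

    The asymptotic part rests on a Stolz-Cesaro argument: if f_j / j^(- tau)
    tends to L, then the sum of f_j over j <= d, divided by d^(1 - tau), tends to
    L / (1 - tau) ([regular_sum]). The upper bound keeps slightly more
    coordinates than the critical ratio kappa; the lower bound takes
    theta close to c (kappa d)^(- tau) ([N_ratio_nonneg], [N_ratio_neg]). *)

(** * Matrices of low rank *)

Section low_rank.
Context {R : realFieldType}.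

Lemma row_sqnorm_eq0 n (v : 'rV[R]_n) : v *m v^T = 0 -> v = 0.
Proof.
move=> /matrixP/(_ ord0 ord0); rewrite !mxE => /psumr_eq0P v0.
apply/rowP => i; rewrite mxE; apply/eqP.
have /= := v0 _ i isT; rewrite !mxE -expr2 => v0'.
by rewrite -sqrf_eq0 v0'// => k _; rewrite mxE -expr2 sqr_ge0.
Qed.

(** If the rows of [U] form a basis of the row space of [W^T], the Gram matrix
    U U^T is invertible, because the standard form on row vectors is definite;
    then U^T (U U^T)^-1 U is the orthogonal projection on the column space of
    [W]. Its trace is the size of [U], by cyclicity. *)
Lemma orthogonal_projection N n (W : 'M[R]_(N, n)) :
  exists Pi : 'M[R]_N,
    [/\ Pi^T = Pi, Pi *m Pi = Pi, Pi *m W = W & \tr Pi <= n%:R].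
Proof.
have [r [U [rn Ufree WU]]] : exists r, exists U : 'M[R]_(r, N),
    [/\ (r <= n)%N, row_free U & (W^T <= U)%MS].
  exists (\rank W^T), (row_base W^T).
  by rewrite row_base_free eq_row_base mxrank_tr rank_leq_col.
have Gunit : U *m U^T \in unitmx.
  rewrite -row_free_unit -kermx_eq0; apply/eqP/row_matrixP => i; rewrite row0.
  have : row i (kermx (U *m U^T)) *m (U *m U^T) = 0.
    by rewrite -row_mul mulmx_ker row0.
  set v := row i _ => /(congr1 (mulmx^~ v^T)).
  rewrite mul0mx mulmxA -mulmxA -trmx_mul => /row_sqnorm_eq0.
  by move/(congr1 (mulmx^~ (pinvmx U))); rewrite -mulmxA mulmxVp// mulmx1 mul0mx.
move GE : (U *m U^T) => G in Gunit.
have GT : G^T = G by rewrite -GE trmx_mul trmxK.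
exists (U^T *m invmx G *m U); split.
- by rewrite !trmx_mul trmxK trmx_inv GT mulmxA.
- rewrite !mulmxA -[_ *m U *m U^T]mulmxA GE.
  by rewrite -[_ *m invmx G *m G]mulmxA mulVmx// mulmx1.
- have /submxP[D WD] := WU.
  have {1}-> : W = U^T *m D^T by rewrite -trmx_mul -WD trmxK.
  rewrite !mulmxA -[_ *m U *m U^T]mulmxA GE -[_ *m invmx G *m G]mulmxA mulVmx//.
  by rewrite mulmx1 -trmx_mul -WD trmxK.
- by rewrite mxtrace_mulC mulmxA GE mulmxV// mxtrace1 ler_nat.
Qed.

(** Write W and C for the matrices of [a] and [c]. Column l of 1 - W C is the basis
    vector e_l minus a vector of the column space of W, so its squared norm is at
    least the squared distance 1 - Pi_ll of e_l to that space, Pi being the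
    orthogonal projection. As 0 <= Pi_ll and the trace of Pi is at most [n],
    the weighted sum of these distances is at least the left side. *)
Lemma low_rank_defect (I : finType) n (a c : I -> 'I_n -> R) (u : I -> R)
    (theta : R) : 0 <= theta -> (forall i, 0 <= u i <= theta) ->
  \sum_i u i - theta * n%:R <=
  \sum_l u l * \sum_i ((i == l)%:R - \sum_m a i m * c l m) ^+ 2.
Proof.
move=> theta0 u0.
have sumE (F : I -> R) : \sum_i F i = \sum_(k < #|I|) F (enum_val k).
  exact: (reindex _ (onW_bij _ (@enum_val_bij I))).
pose W : 'M[R]_(#|I|, n) := \matrix_(k, m) a (enum_val k) m.
pose C : 'M[R]_(n, #|I|) := \matrix_(m, k) c (enum_val k) m.
have [Pi [PiT PiPi PiW trPi]] := orthogonal_projection W.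
pose V := 1%:M - W *m C.
have VE k l : V k l =
    (enum_val k == enum_val l)%:R - \sum_m a (enum_val k) m * c (enum_val l) m.
  rewrite !mxE (inj_eq enum_val_inj); congr (_ - _).
  by apply: eq_bigr => m _; rewrite !mxE.
have sqE (A : 'M[R]_#|I|) l : (A^T *m A) l l = \sum_k A k l ^+ 2.
  by rewrite mxE; apply: eq_bigr => k _; rewrite !mxE expr2.
have sq_ge0 (A : 'M[R]_#|I|) l : 0 <= (A^T *m A) l l.
  by rewrite sqE sumr_ge0// => k _; rewrite sqr_ge0.
have PiE : Pi^T *m Pi = Pi by rewrite PiT PiPi.
(* the component of [V] orthogonal to the columns of [W] does not depend on [C] *)
have PV : (1%:M - Pi) *m V = 1%:M - Pi.
  by rewrite /V mulmxBr mulmx1 mulmxA mulmxBl mul1mx PiW subrr mul0mx subr0.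
(* Pythagoras for the columns of [V] *)
have VV : V^T *m V = (Pi *m V)^T *m (Pi *m V) + (1%:M - Pi).
  have -> : (Pi *m V)^T *m (Pi *m V) = V^T *m (Pi *m V).
    by rewrite trmx_mul -mulmxA (mulmxA Pi^T) PiE.
  have -> : 1%:M - Pi = V^T *m ((1%:M - Pi) *m V).
    rewrite PV -{2}PiT -[in RHS]trmx1 -linearB/= -trmx_mul PV.
    by rewrite linearB/= trmx1 PiT.
  by rewrite -mulmxDr -mulmxDl addrC subrK mul1mx.
rewrite !sumE; apply: (@le_trans _ _ (\sum_k u (enum_val k) * (1 - Pi k k))).
  under [leRHS]eq_bigr do rewrite mulrBr mulr1.
  rewrite sumrB lerB// (@le_trans _ _ (theta * \tr Pi))//; last first.
    exact: ler_wpM2l.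
  rewrite mulr_sumr; apply: ler_sum => k _; rewrite ler_wpM2r//.
    by rewrite -PiE.
  by case/andP: (u0 (enum_val k)).
apply: ler_sum => l _; apply: ler_wpM2l; first by case/andP: (u0 (enum_val l)).
rewrite sumE; under [leRHS]eq_bigr do rewrite -VE.
rewrite -sqE VV mxE [X in _ <= _ + X](_ : _ = 1 - Pi l l) ?lerDr//.
by rewrite !mxE eqxx.
Qed.

End low_rank.

(** * Inner products and Bessel inequality in L_2 *)

Section L2.
Context d {T : measurableType d} {R : realType}.
Variable mu : {finite_measure set T -> \bar R}.
Local Notation L2 := (Lfun mu 2%:E).
Implicit Types f g : T -> R.

Definition dot f g : R := \int[mu]_t (f t * g t).

Lemma L2P f :
  f \in L2 <-> measurable_fun setT f /\ (\int[mu]_t (f t ^+ 2)%:E < +oo)%E.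
Proof.
split=> [fL|[mf f2]].
  split; first by move: fL; rewrite inE => /andP[/[!inE]].
  by have /integrable_lty := Lfun2_integrable_sqr fL; exact.
rewrite inE; apply/andP; split; rewrite inE//=.
rewrite /finite_norm unlock /Lnorm poweR_lty//.
by under eq_integral do rewrite /= powR_mulrn// real_normK ?num_real//.
Qed.

Lemma L2_measurable f : f \in L2 -> measurable_fun setT f.
Proof. by case/L2P. Qed.

Lemma L2_linear a f g : f \in L2 -> g \in L2 -> (fun t => a * f t + g t) \in L2.
Proof. by move=> fL gL; have [_ ->] := @Lfun_submod_closed _ T R mu 2%:E (lee1n _). Qed.

Lemma L2_cst a : (fun=> a) \in L2.
Proof. exact: Lfun_cst. Qed.

Lemma L2_scale a f : f \in L2 -> (fun t => a * f t) \in L2.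
Proof.
move=> fL; have := L2_linear a fL (L2_cst 0).
by under eq_fun do rewrite addr0.
Qed.

Lemma L2_sum (I : Type) (s : seq I) (P : pred I) (F : I -> T -> R) :
  (forall i, F i \in L2) -> (fun t => \sum_(i <- s | P i) F i t) \in L2.
Proof.
move=> FL; elim: s => [|i s ih].
  by under eq_fun do rewrite big_nil; exact: L2_cst.
under eq_fun do rewrite big_cons; case: (P i) => //.
by have := L2_linear 1 (FL i) ih; under eq_fun do rewrite mul1r.
Qed.

Lemma L2_sub f g : f \in L2 -> g \in L2 -> (fun t => f t - g t) \in L2.
Proof.
move=> fL gL; have := L2_linear (-1) gL fL.
by under eq_fun do rewrite mulN1r addrC.
Qed.

Lemma L2_mul_integrable f g : f \in L2 -> g \in L2 ->
  mu.-integrable setT (EFin \o (fun t => f t * g t)).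
Proof. by move=> fL gL; apply/Lfun1_integrable; exact: Lfun2_mul_Lfun1. Qed.

Lemma dotC f g : dot f g = dot g f.
Proof. by apply: eq_Rintegral => t _; rewrite mulrC. Qed.

Lemma dot_linearl a f g h : f \in L2 -> g \in L2 -> h \in L2 ->
  dot (fun t => a * f t + g t) h = a * dot f h + dot g h.
Proof.
move=> fL gL hL; rewrite /dot -RintegralZl//; last exact: L2_mul_integrable.
rewrite -RintegralD//; last 2 first.
- have := L2_mul_integrable (L2_scale a fL) hL.
  by congr (integrable _ _ _); apply/funext => t /=; rewrite mulrA.
- exact: L2_mul_integrable.
by apply: eq_Rintegral => t _; rewrite mulrDl mulrA.
Qed.

Lemma dot0l h : dot (fun=> 0) h = 0.
Proof.
rewrite /dot (_ : (fun t => _) = cst 0); last by apply/funext => t; rewrite mul0r.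
by rewrite Rintegral_cst ?mul0r.
Qed.

Lemma dot_suml (I : Type) (s : seq I) (P : pred I) (a : I -> R) (F : I -> T -> R) h :
  (forall i, F i \in L2) -> h \in L2 ->
  dot (fun t => \sum_(i <- s | P i) a i * F i t) h =
  \sum_(i <- s | P i) a i * dot (F i) h.
Proof.
move=> FL hL; elim: s => [|i s ih].
  by under eq_fun do rewrite big_nil; rewrite big_nil dot0l.
rewrite big_cons; under eq_fun do rewrite big_cons; case: (P i) => //.
rewrite dot_linearl ?ih//; apply: L2_sum => j; exact: L2_scale.
Qed.

Lemma dot_subl f g h : f \in L2 -> g \in L2 -> h \in L2 ->
  dot (fun t => f t - g t) h = dot f h - dot g h.
Proof.
move=> fL gL hL; rewrite -[LHS](_ : dot (fun t => -1 * g t + f t) h = _).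
  by rewrite dot_linearl// mulN1r addrC.
by under eq_fun do rewrite mulN1r addrC.
Qed.

Lemma dot_ge0 f : 0 <= dot f f.
Proof. by apply: Rintegral_ge0 => t _; rewrite -expr2 sqr_ge0. Qed.

Lemma integral_dot f g : f \in L2 -> g \in L2 ->
  (\int[mu]_t (f t * g t)%:E)%E = (dot f g)%:E.
Proof.
move=> fL gL; rewrite /dot /Rintegral fineK//.
exact/integrable_fin_num/L2_mul_integrable.
Qed.

Lemma integral_sqr f : f \in L2 -> (\int[mu]_t (f t ^+ 2)%:E)%E = (dot f f)%:E.
Proof. by move=> fL; rewrite -integral_dot. Qed.

Definition orthonormal (I : finType) (phi : I -> T -> R) :=
  (forall i, phi i \in L2) /\ forall i j, dot (phi i) (phi j) = (i == j)%:R.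

(** Pythagoras: the orthogonal projection [p] of [f] is orthogonal to f - p. *)
Lemma orthonormal_sub (I : finType) (phi : I -> T -> R) (S : {set I}) f :
  orthonormal phi -> f \in L2 ->
  let g t := f t - \sum_(i in S) dot f (phi i) * phi i t in
  dot g g = dot f f - \sum_(i in S) dot f (phi i) ^+ 2.
Proof.
move=> [phiL phiO] fL g.
pose p t := \sum_(i in S) dot f (phi i) * phi i t.
have pL : p \in L2 by apply: L2_sum => i; exact: L2_scale.
have gL : g \in L2 by exact: L2_sub.
have pphi i : i \in S -> dot p (phi i) = dot f (phi i).
  move=> iS; rewrite dot_suml// (bigD1 i)//= phiO eqxx mulr1 big1 ?addr0//.
  by move=> j /andP[_ ji]; rewrite phiO (negbTE ji) mulr0.
have gp : dot g p = 0.
  rewrite dotC /p dot_suml// big1// => i iS.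
  by rewrite [dot _ g]dotC dot_subl// pphi// subrr mulr0.
rewrite {1}/g dot_subl//; rewrite [dot _ g in X in _ - X](_ : _ = 0).
  rewrite subr0 dotC dot_subl// dotC; congr (_ - _).
  by rewrite dotC dot_suml//; apply: eq_bigr => i _; rewrite [dot (phi i) f]dotC expr2.
by rewrite dotC.
Qed.

Lemma bessel (I : finType) (phi : I -> T -> R) f : orthonormal phi -> f \in L2 ->
  \sum_i dot f (phi i) ^+ 2 <= dot f f.
Proof.
move=> phiO fL; rewrite -subr_ge0.
have /= := orthonormal_sub [set: I] phiO fL.
rewrite (eq_bigl xpredT); last by move=> i; rewrite inE.
by move=> <-; exact: dot_ge0.
Qed.

End L2.

(** * Integrals on product spaces *)

Section product_functions.
Context d1 d2 {T1 : measurableType d1} {T2 : measurableType d2} {R : realType}.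
Variables (m1 : {sigma_finite_measure set T1 -> \bar R})
  (m2 : {sigma_finite_measure set T2 -> \bar R}) (a : T1 -> R) (b : T2 -> R).
Hypotheses (ia : m1.-integrable setT (EFin \o a))
  (ib : m2.-integrable setT (EFin \o b)).

Let ma : measurable_fun setT a.
Proof. exact/measurable_EFinP/measurable_int/ia. Qed.

Let mb : measurable_fun setT b.
Proof. exact/measurable_EFinP/measurable_int/ib. Qed.

Lemma integrable_tensor :
  (m1 \x m2)%E.-integrable setT (fun p => (a p.1 * b p.2)%:E).
Proof.
apply/integrable12ltyP => /=.
  apply/measurable_EFinP; apply: measurable_funM.
    exact: measurableT_comp.
  exact: measurableT_comp.
have [B BE] : exists B, (\int[m2]_y `|(b y)%:E| = B%:E)%E.
  exists (fine (\int[m2]_y `|(b y)%:E|)%E).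
  rewrite fineK// ge0_fin_numE ?integral_ge0//.
  by case/integrableP : ib.
have inner x : (\int[m2]_y `|(a x * b y)%:E| = `|a x|%:E * B%:E)%E.
  under eq_integral do rewrite EFinM abseM.
  rewrite ge0_integralZl ?BE//.
  by apply: measurableT_comp => //; exact/measurable_EFinP.
under eq_integral do rewrite inner.
have B0 : 0 <= B by rewrite -lee_fin -BE integral_ge0.
rewrite ge0_integralZr ?lee_fin//; last first.
  by apply/measurable_EFinP; exact: measurableT_comp.
rewrite lte_mul_pinfty ?integral_ge0 ?ltry// ge0_fin_numE ?integral_ge0//.
by case/integrableP : ia.
Qed.

Lemma Rintegral_tensor :
  \int[(m1 \x m2)%E]_p (a p.1 * b p.2) = (\int[m1]_x a x) * (\int[m2]_y b y).
Proof.
rewrite /Rintegral -integral12_prod_meas1; last exact: integrable_tensor.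
rewrite /fubini_F /=.
have inner x : (\int[m2]_y (a x * b y)%:E = (a x)%:E * \int[m2]_y (b y)%:E)%E.
  by under eq_integral do rewrite EFinM; rewrite integralZl.
under eq_integral do rewrite inner.
have bfin := integrable_fin_num measurableT ib.
rewrite -(fineK bfin) integralZr// fineM//.
exact: integrable_fin_num.
Qed.

End product_functions.

Section measurable_fubini.
Local Open Scope ereal_scope.
Context d1 d2 {T1 : measurableType d1} {T2 : measurableType d2} {R : realType}.
Variable m2 : {sigma_finite_measure set T2 -> \bar R}.

(** The integral of a section is by definition the difference of the integrals
    of its positive and negative parts, so Tonelli suffices and [f] need not be
    integrable. *)
Lemma measurable_integral_section (f : T1 * T2 -> \bar R) :
  measurable_fun setT f -> measurable_fun setT (fun x => \int[m2]_y f (x, y)).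
Proof.
move=> mf.
have -> : (fun x => \int[m2]_y f (x, y)) =
    (fun x => \int[m2]_y f^\+ (x, y)) \- (fun x => \int[m2]_y f^\- (x, y)).
  apply/funext => x; rewrite [LHS]integralE; congr (_ - _).
    by apply: eq_integral => y _; rewrite !funeposE.
  by apply: eq_integral => y _; rewrite !funenegE.
apply: emeasurable_funB.
  by apply: (measurable_fun_fubini_tonelli_F f^\+) => //; exact: measurable_funepos.
by apply: (measurable_fun_fubini_tonelli_F f^\-) => //; exact: measurable_funeneg.
Qed.

End measurable_fubini.

(** * Approximation of random fields of finite second order *)

Section second_order_field.
Context dT dO {T : measurableType dT} {Omega : measurableType dO} {R : realType}.
Variables (mu : probability T R) (P : probability Omega R).
Variables (X : Omega * T -> R) (K : T -> T -> R) (M : R).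
Hypothesis mX : measurable_fun setT X.
Hypothesis XK : forall t s, (\int[P]_w (X (w, t) * X (w, s))%:E)%E = (K t s)%:E.
Hypothesis KM : forall t, K t t <= M.
Local Notation L2 := (Lfun mu 2%:E).

Definition coef (g : T -> R) w : R := dot mu (fun t => X (w, t)) g.

Let mX1 w : measurable_fun setT (fun t => X (w, t)).
Proof. exact: measurableT_comp. Qed.

Let mX2 t : measurable_fun setT (fun w => X (w, t)).
Proof. exact: measurableT_comp. Qed.

Lemma measurable_coef g : measurable_fun setT g -> measurable_fun setT (coef g).
Proof.
move=> mg; rewrite /coef /dot /Rintegral.
apply: measurableT_comp => //.
apply: (measurable_integral_section mu
  (f := fun p : Omega * T => (X p * g p.2)%:E)).
apply/measurable_EFinP; apply: measurable_funM => //.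
exact: measurableT_comp.
Qed.

Lemma integral_sqr_field :
  (\int[P]_w \int[mu]_t (X (w, t) ^+ 2)%:E)%E = (\int[mu]_t (K t t)%:E)%E.
Proof.
rewrite (fubini_tonelli (fun p : Omega * T => (X p ^+ 2)%:E))//=.
- by apply: eq_integral => t _; rewrite -XK; apply: eq_integral => w _; rewrite expr2.
- by apply/measurable_EFinP; exact: measurable_funX.
- by move=> p; rewrite lee_fin sqr_ge0.
Qed.

Let M_ge0 : 0 <= M.
Proof.
have [t _] : exists t : T, True by exists point.
by rewrite (le_trans _ (KM t))// -lee_fin -XK integral_ge0// => w _;
  rewrite lee_fin -expr2 sqr_ge0.
Qed.

Let measurable_sqnorm : measurable_fun setT
  (fun w => \int[mu]_t (X (w, t) ^+ 2)%:E)%E.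
Proof.
apply: (measurable_integral_section mu
  (f := fun p : Omega * T => (X p ^+ 2)%:E)).
by apply/measurable_EFinP; exact: measurable_funX.
Qed.

Lemma integral_sqr_field_le :
  (\int[P]_w \int[mu]_t (X (w, t) ^+ 2)%:E <= M%:E)%E.
Proof.
rewrite integral_sqr_field; apply: (@le_trans _ _ (\int[mu]_t (cst M%:E t))%E).
  apply: ge0_le_integral => //.
  - by move=> t _; rewrite -XK integral_ge0// => w _; rewrite lee_fin -expr2 sqr_ge0.
  - under eq_fun do rewrite -XK.
    apply: (measurable_fun_fubini_tonelli_G (fun p : Omega * T => (X p * X p)%:E)).
      by apply/measurable_EFinP; exact: measurable_funM.
    by move=> p; rewrite lee_fin -expr2 sqr_ge0.
  - by move=> t _; rewrite lee_fin.
by rewrite integral_cst//= probability_setT mule1.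
Qed.

(** The expectation of the squared norm of the path is at most [M], hence the
    squared norm is almost surely finite. *)
Lemma ae_L2_field : {ae P, forall w, (fun t => X (w, t)) \in L2}.
Proof.
have : P.-integrable setT (fun w => \int[mu]_t (X (w, t) ^+ 2)%:E)%E.
  apply/integrableP; split => //.
  under eq_integral => w _.
    rewrite gee0_abs; last by apply: integral_ge0 => t _; rewrite lee_fin sqr_ge0.
    over.
  exact: le_lt_trans integral_sqr_field_le (ltry M).
move=> /(integrable_ae measurableT); apply: filterS => w /(_ I) fin.
apply/L2P; split => //.
by rewrite -ge0_fin_numE// integral_ge0// => t _; rewrite lee_fin sqr_ge0.
Qed.

(** By 2 |x y| <= x^2 + y^2, the bound on the diagonal of [K] controls all the
    mixed second moments. *)
Lemma integral_abs_field2 t s :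
  (\int[P]_w `|X (w, t) * X (w, s)|%:E <= M%:E)%E.
Proof.
apply: (@le_trans _ _
  (\int[P]_w (2^-1%:E * ((X (w, t) * X (w, t))%:E + (X (w, s) * X (w, s))%:E)))%E).
  apply: ge0_le_integral => //.
  - by apply/measurable_EFinP/measurableT_comp => //; exact: measurable_funM.
  - apply: measurable_funeM; apply: emeasurable_funD.
      by apply/measurable_EFinP; exact: measurable_funM.
    by apply/measurable_EFinP; exact: measurable_funM.
  move=> w _; rewrite -EFinD -EFinM lee_fin ler_norml.
  have := sqr_ge0 (X (w, t) - X (w, s)); have := sqr_ge0 (X (w, t) + X (w, s)).
  rewrite sqrrD sqrrB !expr2; lra.
have sq0 r : forall w : Omega, setT w -> (0 <= (X (w, r) * X (w, r))%:E)%E.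
  by move=> w _; rewrite lee_fin -expr2 sqr_ge0.
have msq r : measurable_fun setT (fun w => (X (w, r) * X (w, r))%:E).
  by apply/measurable_EFinP; exact: measurable_funM.
rewrite ge0_integralZl//; last 2 first.
- exact: emeasurable_funD.
- by move=> w _; rewrite adde_ge0 ?sq0.
rewrite ge0_integralD ?XK ?measurableT//; try exact: sq0.
rewrite -EFinD -EFinM lee_fin.
have := KM t; have := KM s; lra.
Qed.

Let nu : probability (T * T)%type R := (mu \x mu)%E.

(** (X, g)^2 is the integral over pairs (t, s) of g(t) g(s) X(t) X(s). With the
    pair as a single variable, E (X, g)^2 is computed by one application of
    Fubini's theorem on the product of [Omega] and T x T. *)
Let cov2 g (p : Omega * (T * T)) :=
  g p.2.1 * g p.2.2 * (X (p.1, p.2.1) * X (p.1, p.2.2)).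

Let integrable_L2 g : g \in L2 -> mu.-integrable setT (EFin \o g).
Proof.
move=> gL; have := L2_mul_integrable gL (L2_cst mu 1).
by apply: eq_integrable => // t _ /=; rewrite mulr1.
Qed.

Let measurable_cov2 g : g \in L2 -> measurable_fun setT (cov2 g).
Proof.
move=> /L2_measurable mg; apply: measurable_funM; apply: measurable_funM.
- by apply: measurableT_comp => //; apply: measurableT_comp.
- by apply: measurableT_comp => //; apply: measurableT_comp.
- apply: measurableT_comp => //; apply: measurable_fun_pair => //.
  exact: measurableT_comp.
- apply: measurableT_comp => //; apply: measurable_fun_pair => //.
  exact: measurableT_comp.
Qed.

Let integrable_gg g : g \in L2 ->
  nu.-integrable setT (EFin \o (fun p => g p.1 * g p.2)).
Proof. by move=> /integrable_L2 ig; exact: integrable_tensor. Qed.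

Let integrable_cov2 g : g \in L2 ->
  (P \x nu)%E.-integrable setT (EFin \o cov2 g).
Proof.
move=> gL; have mc := measurable_cov2 gL.
have /measurable_int mgg := integrable_gg gL.
apply/integrable21ltyP; first exact/measurable_EFinP.
apply: (@le_lt_trans _ _
   (\int[nu]_p (`|(g p.1 * g p.2)%:E| * M%:E))%E).
  apply: ge0_le_integral => //.
  - by move=> p _; exact: integral_ge0.
  - apply: (measurable_fun_fubini_tonelli_G
      (fun p => `|(cov2 g p)%:E|%E)) => //.
    by apply: measurableT_comp => //; exact/measurable_EFinP.
  - apply: emeasurable_funM => //; exact: measurableT_comp.
  move=> p _ /=.
  under eq_integral do rewrite /cov2 /= normrM EFinM.
  rewrite ge0_integralZl//; last first.
    by apply/measurable_EFinP/measurableT_comp => //; exact: measurable_funM.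
  by apply: lee_pmul => //; [exact: integral_ge0|exact: integral_abs_field2].
rewrite ge0_integralZr// ?lee_fin//; last exact: measurableT_comp.
rewrite lte_mul_pinfty ?integral_ge0 ?ltry// ge0_fin_numE ?integral_ge0//.
by case/integrableP : (integrable_gg gL).
Qed.

Let field_quad g : g \in L2 ->
  (\int[P]_w (coef g w ^+ 2)%:E)%E =
  (\int[nu]_p (g p.1 * g p.2 * K p.1 p.2)%:E)%E.
Proof.
move=> gL; have mg := L2_measurable gL.
transitivity (\int[P]_w \int[nu]_p (cov2 g (w, p))%:E)%E.
  apply: ae_eq_integral => //.
  - apply/measurable_EFinP/measurable_funX; exact: measurable_coef.
  - exact: (measurable_fubini_F (integrable_cov2 gL)).
  apply: filterS ae_L2_field => w XL _.
  have iXg := L2_mul_integrable XL gL.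
  rewrite /coef expr2 -Rintegral_tensor// /Rintegral fineK; last first.
    exact: (integrable_fin_num measurableT (integrable_tensor iXg iXg)).
  by apply: eq_integral => p _ /=; rewrite /cov2 /=; congr EFin; ring.
rewrite (Fubini (integrable_cov2 gL)); apply: eq_integral => p _ /=.
under eq_integral do rewrite /cov2/= EFinM.
rewrite integralZl// ?XK ?EFinM//.
apply/integrableP; split; first by apply/measurable_EFinP; exact: measurable_funM.
exact: le_lt_trans (integral_abs_field2 _ _) (ltry M).
Qed.

Let integrable_quad g : g \in L2 ->
  nu.-integrable setT (EFin \o (fun p => g p.1 * g p.2 * K p.1 p.2)).
Proof.
move=> gL.
have KE p : (g p.1 * g p.2 * K p.1 p.2)%:E = fubini_G P (EFin \o cov2 g) p.
  rewrite /fubini_G /cov2 /=; under eq_integral do rewrite EFinM.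
  rewrite integralZl// ?XK ?EFinM//.
  apply/integrableP; split; first by apply/measurable_EFinP; exact: measurable_funM.
  exact: le_lt_trans (integral_abs_field2 _ _) (ltry M).
have Kle t s : `|K t s| <= M.
  rewrite -lee_fin (le_trans _ (integral_abs_field2 t s))// -abse_EFin -XK.
  by apply: le_abse_integral => //; apply/measurable_EFinP; exact: measurable_funM.
apply: (le_integrable measurableT _ _ (integrableZr measurableT M (integrable_gg gL))).
  rewrite (_ : _ \o _ = fubini_G P (EFin \o cov2 g)).
    exact: (measurable_fubini_G (integrable_cov2 gL)).
  by apply/funext => p /=; rewrite KE.
move=> p _ /=; rewrite lee_fin normrM [in leRHS]normrM [`|M|]ger0_norm//.
exact: ler_wpM2l.
Qed.

(** For a kernel sum_j h_j(t) h_j(s) the quadratic form is sum_j (h_j, g)^2; a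
    uniform error [delta] on the kernel costs at most [delta] times the square
    of the L_1 norm of g. *)
Let quad_ge g (J : finType) (h : J -> T -> R) (delta : R) :
    g \in L2 -> (forall j, h j \in L2) ->
    (forall t s, `|K t s - \sum_j h j t * h j s| <= delta) ->
  ((\sum_j dot mu (h j) g ^+ 2 - delta * (\int[mu]_t `|g t|) ^+ 2)%:E <=
   \int[nu]_p (g p.1 * g p.2 * K p.1 p.2)%:E)%E.
Proof.
move=> gL hL Kh.
have ig : mu.-integrable setT (EFin \o (fun t => `|g t|)).
  exact: (integrable_norm (integrable_L2 gL)).
pose f j (p : T * T) := (h j p.1 * g p.1) * (h j p.2 * g p.2).
have if_ j : nu.-integrable setT (EFin \o f j).
  by have hg := L2_mul_integrable (hL j) gL; exact: (integrable_tensor hg hg).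
have intf j : \int[nu]_p f j p = dot mu (h j) g ^+ 2.
  by have hg := L2_mul_integrable (hL j) gL; rewrite expr2; exact: (Rintegral_tensor hg hg).
pose b (p : T * T) := delta * (`|g p.1| * `|g p.2|).
have ib0 : nu.-integrable setT (EFin \o (fun p => `|g p.1| * `|g p.2|)).
  exact: (integrable_tensor ig ig).
have ib : nu.-integrable setT (EFin \o b).
  have := integrableZl measurableT delta ib0.
  by apply: eq_integrable => // p _; rewrite /= /b EFinM.
have intb : \int[nu]_p b p = delta * (\int[mu]_t `|g t|) ^+ 2.
  by rewrite RintegralZl// expr2; congr (_ * _); exact/(Rintegral_tensor ig ig).
have isf : nu.-integrable setT (EFin \o (fun p => \sum_j f j p)).
  have := integrable_sum measurableT (index_enum J) (P := xpredT)
    (fun j _ => if_ j).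
  by apply: eq_integrable => // p _; rewrite /= sumEFin.
have intsf : \int[nu]_p (\sum_j f j p) = \sum_j dot mu (h j) g ^+ 2.
  under [RHS]eq_bigr do rewrite -intf.
  rewrite /Rintegral; under eq_integral do rewrite -sumEFin.
  rewrite integral_sum// -sum_fine// => j _.
  exact: (integrable_fin_num measurableT (if_ j)).
have iB : nu.-integrable setT (EFin \o (fun p => \sum_j f j p - b p)).
  have := integrableB measurableT isf ib.
  by apply: eq_integrable => // p _; rewrite /= EFinB.
rewrite -intb -intsf -RintegralB// /Rintegral fineK; last first.
  exact: (integrable_fin_num measurableT iB).
apply: le_integral => //.
- exact: integrable_quad.
move=> p _; rewrite lee_fin.
have -> : \sum_j f j p = g p.1 * g p.2 * \sum_j h j p.1 * h j p.2.
  by rewrite mulr_sumr; apply: eq_bigr => j _; rewrite /f; ring.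
rewrite lerBlDr -lerBlDl -mulrBr /b.
apply: le_trans (ler_norm _) _; rewrite !normrM distrC mulrC.
by apply: ler_wpM2r => //; rewrite mulr_ge0.
Qed.

Variables (I : finType) (phi : I -> T -> R) (lam : I -> R).
Hypothesis phiO : orthonormal mu phi.
(** A form of the operator inequality between the covariance and
    sum_i lam_i phi_i(t) phi_i(s) that makes no reference to the spectrum of K:
    up to a uniform error, K is a finite sum of squares that dominates
    sum_i lam_i (phi_i, g)^2. *)
Hypothesis K_ge : forall delta, 0 < delta ->
  exists (J : finType) (h : J -> T -> R),
    [/\ forall j, h j \in L2,
        forall t s, `|K t s - \sum_j h j t * h j s| <= delta &
        forall g, g \in L2 ->
          \sum_i lam i * dot mu (phi i) g ^+ 2 <= \sum_j dot mu (h j) g ^+ 2].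

Lemma variance_coef_ge g : g \in L2 ->
  ((\sum_i lam i * dot mu (phi i) g ^+ 2)%:E <=
   \int[P]_w (coef g w ^+ 2)%:E)%E.
Proof.
move=> gL; rewrite field_quad//; apply/lee_addgt0Pr => e e0.
pose N := (\int[mu]_t `|g t|) ^+ 2.
have N0 : 0 < 1 + N by rewrite ltr_pwDl// sqr_ge0.
have [J [h [hL Kh hge]]] := K_ge (divr_gt0 e0 N0).
rewrite -leeBlDr//; apply: le_trans (quad_ge gL hL Kh).
rewrite -EFinB lee_fin -/N.
rewrite lerB// ?hge// mulrAC ler_pdivrMr// ler_pM2l//; lra.
Qed.

Section approximation_by_projections.
Variables (n : nat) (psi : 'I_n -> T -> R).
Hypothesis psiL : forall m, psi m \in L2.

Let res (p : Omega * T) := X p - \sum_m coef (psi m) p.1 * psi m p.2.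

Let measurable_res : measurable_fun setT res.
Proof.
apply: measurable_funB => //; apply: measurable_sum => m.
apply: measurable_funM; apply: measurableT_comp => //.
  exact/measurable_coef/L2_measurable/psiL.
exact/L2_measurable/psiL.
Qed.

Lemma measurable_sqnorm_residual : measurable_fun setT
  (fun w => \int[mu]_t ((X (w, t) - \sum_m coef (psi m) w * psi m t) ^+ 2)%:E)%E.
Proof.
apply: (measurable_integral_section mu (f := fun p : Omega * T => (res p ^+ 2)%:E)).
by apply/measurable_EFinP; exact: measurable_funX.
Qed.

(** Let A f = f - sum_m (f, psi_m) psi_m, a self-adjoint operator, and g_i = A phi_i.
    By Bessel, |A X|^2 >= sum_i (A X, phi_i)^2 = sum_i (X, g_i)^2, whose
    expectation is at least sum_l lam_l sum_i (phi_l, g_i)^2 by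
    [variance_coef_ge]. The numbers (phi_l, g_i) are the entries of the identity
    minus a matrix of rank at most [n], and [low_rank_defect] applies with the
    weights u_l <= lam_l. *)
Lemma residual_ge (u : I -> R) (theta : R) : 0 <= theta ->
  (forall i, 0 <= u i <= theta) -> (forall i, u i <= lam i) ->
  ((\sum_i u i - theta * n%:R)%:E <= \int[P]_w \int[mu]_t
     ((X (w, t) - \sum_m coef (psi m) w * psi m t) ^+ 2)%:E)%E.
Proof.
move=> theta0 u0 ulam; have [phiL phi1] := phiO.
pose g i t := phi i t - \sum_m dot mu (psi m) (phi i) * psi m t.
have gL i : g i \in L2.
  by apply: L2_sub => //; apply: L2_sum => m; exact: L2_scale.
apply: (@le_trans _ _ (\int[P]_w (\sum_i coef (g i) w ^+ 2)%:E)%E); last first.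
  apply: ae_ge0_le_integral => //.
  - by move=> w _; rewrite lee_fin sumr_ge0// => i _; rewrite sqr_ge0.
  - apply/measurable_EFinP/measurable_sum => i; apply: measurable_funX.
    exact: (measurable_coef (L2_measurable (gL i))).
  - by move=> w _; apply: integral_ge0 => t _; rewrite lee_fin sqr_ge0.
  - exact: measurable_sqnorm_residual.
  apply: filterS ae_L2_field => w XL _.
  have pL : (fun t => \sum_m coef (psi m) w * psi m t) \in L2.
    by apply: L2_sum => m; exact: L2_scale.
  rewrite integral_sqr; last exact: L2_sub.
  rewrite lee_fin; apply: le_trans (bessel phiO (L2_sub XL pL)).
  apply: ler_sum => i _; rewrite le_eqVlt; apply/orP; left; apply/eqP.
  (* self-adjointness: (A X, phi_i) = (X, A phi_i) *)
  congr (_ ^+ 2); rewrite dot_subl// dot_suml// /coef dotC dot_subl//; last first.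
    by apply: L2_sum => m; exact: L2_scale.
  rewrite dotC dot_suml//; congr (_ - _); apply: eq_bigr => m _.
  by rewrite mulrC [dot mu (psi m) (fun _ => _)]dotC.
under eq_integral do rewrite -sumEFin.
rewrite ge0_integral_sum//; last 2 first.
- by move=> i; apply/measurable_EFinP/measurable_funX/measurable_coef/(L2_measurable (gL i)).
- by move=> i w _; rewrite lee_fin sqr_ge0.
apply: (@le_trans _ _
    (\sum_i (\sum_l lam l * dot mu (phi l) (g i) ^+ 2)%:E)%E); last first.
  by apply: lee_sum => i _; exact: variance_coef_ge.
rewrite sumEFin lee_fin exchange_big/=.
apply: le_trans (low_rank_defect (fun i m => dot mu (psi m) (phi i))
  (fun l m => dot mu (psi m) (phi l)) theta0 u0) _.
apply: ler_sum => l _; rewrite -mulr_sumr.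
have -> : \sum_i ((i == l)%:R -
    \sum_m dot mu (psi m) (phi i) * dot mu (psi m) (phi l)) ^+ 2 =
    \sum_i dot mu (phi l) (g i) ^+ 2.
  apply: eq_bigr => i _; congr (_ ^+ 2).
  rewrite dotC dot_subl//; last by apply: L2_sum => m; exact: L2_scale.
  by rewrite phi1 dot_suml.
by apply: ler_wpM2r => //; apply: sumr_ge0 => i _; rewrite sqr_ge0.
Qed.

End approximation_by_projections.

(** The projection on the span of the phi_i with i in [S] removes exactly
    sum_(i in S) (X, phi_i)^2 from the squared norm, and
    E (X, phi_i)^2 >= lam_i by [variance_coef_ge]. *)
Lemma residual_le (S : {set I}) :
  (\int[P]_w \int[mu]_t
     ((X (w, t) - \sum_(m < #|S|) coef (phi (enum_val m)) w * phi (enum_val m) t)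
        ^+ 2)%:E <= (M - \sum_(i in S) lam i)%:E)%E.
Proof.
have [phiL phi1] := phiO.
pose r w := (\int[mu]_t ((X (w, t) - \sum_(m < #|S|)
  coef (phi (enum_val m)) w * phi (enum_val m) t) ^+ 2)%:E)%E.
pose v w := \sum_(m < #|S|) coef (phi (enum_val m)) w ^+ 2.
have r0 w : (0 <= r w)%E by apply: integral_ge0 => t _; rewrite lee_fin sqr_ge0.
have v0 w : 0 <= v w by apply: sumr_ge0 => m _; rewrite sqr_ge0.
have mr : measurable_fun setT r by exact: measurable_sqnorm_residual.
have mc i : measurable_fun setT (fun w => coef (phi i) w ^+ 2).
  exact/measurable_funX/measurable_coef/(L2_measurable (phiL i)).
have mv : measurable_fun setT v by apply: measurable_sum => m; exact: mc.
rewrite EFinB leeBrDr//.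
apply: (@le_trans _ _ (\int[P]_w (r w + (v w)%:E))%E).
  rewrite [leRHS]ge0_integralD//; last 2 first.
  - by move=> w _; rewrite lee_fin.
  - exact/measurable_EFinP.
  rewrite leeD2l// big_enum_val -sumEFin.
  under eq_integral do rewrite -sumEFin.
  rewrite ge0_integral_sum//; last 2 first.
  - by move=> m; exact/measurable_EFinP.
  - by move=> m w _; rewrite lee_fin sqr_ge0.
  apply: lee_sum => m _; apply: le_trans (variance_coef_ge (phiL _)).
  rewrite lee_fin (bigD1 (enum_val m))//= phi1 eqxx expr1n mulr1 big1 ?addr0//.
  by move=> i /negbTE im; rewrite phi1 im expr0n mulr0.
apply: le_trans integral_sqr_field_le.
apply: ae_ge0_le_integral => //.
- by move=> w _; rewrite adde_ge0// lee_fin.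
- by apply: emeasurable_funD => //; exact/measurable_EFinP.
- by move=> w _; apply: integral_ge0 => t _; rewrite lee_fin sqr_ge0.
apply: filterS ae_L2_field => w XL _; rewrite integral_sqr//.
have /= rE := orthonormal_sub S phiO XL.
rewrite /r integral_sqr; last first.
  by apply: L2_sub => //; apply: L2_sum => m; exact: L2_scale.
have -> : (fun t => X (w, t) - \sum_(m < #|S|)
    coef (phi (enum_val m)) w * phi (enum_val m) t) =
  (fun t => X (w, t) - \sum_(i in S)
    dot mu (fun t => X (w, t)) (phi i) * phi i t).
  by apply/funext => t; rewrite [in RHS]big_enum_val.
by rewrite rE -EFinD big_enum_val subrK.
Qed.

End second_order_field.

(** * Integrals over the cube *)

Section bounded.
Context d {T : measurableType d} {R : realType} (mu : probability T R).

Lemma Rintegral_probability_cst c : \int[mu]_t c = c :> R.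
Proof.
rewrite Rintegral_cst//; transitivity (c * fine (1%E : \bar R)).
  by congr (_ * fine _); exact: probability_setT.
by rewrite mulr1.
Qed.

Lemma bounded_integrable (f : T -> R) (C : R) : measurable_fun setT f ->
  (forall t, `|f t| <= C) -> mu.-integrable setT (EFin \o f).
Proof.
move=> mf fC; apply: measurable_bounded_integrable => //.
  by rewrite -ge0_fin_numE ?fin_num_measure.
by exists C; split; rewrite ?num_real// => x Cx t _; exact: le_trans (fC t) (ltW Cx).
Qed.

Lemma bounded_L2 (f : T -> R) (C : R) : measurable_fun setT f ->
  (forall t, `|f t| <= C) -> f \in Lfun mu 2%:E.
Proof.
move=> mf fC; apply/L2P; split => //.
apply: integrable_lty => //; apply: (bounded_integrable (C := C ^+ 2)).
  exact: measurable_funX.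
by move=> t; rewrite normrX lerXn2r// ?nnegrE// (le_trans _ (fC t)).
Qed.

End bounded.

Section cube_integrals.
Context {R : realType}.
Local Notation RT := (measurableTypeR R).

(** [lebesgue_unit] is a measure on the whole line that vanishes outside
    the unit interval. *)
Lemma integral_lebesgue_unit (f : RT -> R) (C : R) : measurable_fun setT f ->
  (forall x, `|f x| <= C) ->
  \int[lebesgue_unit]_x f x = \int[lebesgue_measure]_(x in `[0, 1]) f x.
Proof.
move=> mf fC; rewrite /Rintegral; congr fine.
pose D : set RT := [set` `[0, 1]%R].
have mD : measurable D by exact: measurable_itv.
have unitE A : lebesgue_unit A = lebesgue_measure (A `&` D) by [].
rewrite (negligible_integral (N := ~` D))//; last 3 first.
- exact: measurableC.
- exact: bounded_integrable fC.
- by apply: etrans (unitE _) _; rewrite setICl measure0.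
rewrite setTD setCK; apply: eq_measure_integral => A mA AD.
by apply: etrans (unitE _) _; rewrite (setIidl AD).
Qed.

(** Induction on [d]: the measure in dimension d + 1 is the image of a product
    measure under [tcons], and the integrand splits off its first factor. *)
Lemma Rintegral_cube_prod d (f : 'I_d -> RT -> R) (C : R) :
    (forall i, measurable_fun setT (f i)) -> (forall i x, `|f i x| <= C) ->
  \int[lebesgue_cube d]_t (\prod_i f i (tnth t i)) =
  \prod_i \int[lebesgue_unit]_x f i x.
Proof.
elim: d f => [|d ih] f mf fC.
  rewrite big_ord0; under eq_Rintegral do rewrite big_ord0.
  exact: Rintegral_probability_cst.
rewrite big_ord_recl -ih//=.
have mp n (h : 'I_n -> RT -> R) : (forall i, measurable_fun setT (h i)) ->
    measurable_fun setT (fun t : n.-tuple RT => \prod_i h i (tnth t i)).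
  move=> mh; apply: measurable_prod => i _.
  apply: measurableT_comp => //; exact: measurable_tnth.
have fprod n (h : 'I_n -> RT -> R) (t : n.-tuple RT) :
    (forall i x, `|h i x| <= C) -> `|\prod_i h i (tnth t i)| <= C ^+ n.
  move=> hC; rewrite normr_prod -[n in leRHS]card_ord -prodr_const.
  by apply: ler_prod => i _; rewrite normr_ge0 hC.
have i0 : lebesgue_unit.-integrable setT (EFin \o f ord0).
  exact: bounded_integrable (fC ord0).
have i1 : (lebesgue_cube d).-integrable setT
    (EFin \o (fun t : d.-tuple RT => \prod_i f (lift ord0 i) (tnth t i))).
  apply: (@bounded_integrable _ _ _ _ _ (C ^+ d)) => [|t].
    by apply: (mp d (fun i => f (lift ord0 i))) => i.
  by apply: (fprod d (fun i => f (lift ord0 i))) => i x.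
rewrite -(Rintegral_tensor i0 i1) /Rintegral; congr fine.
have tc p : \prod_(i < d.+1) f i (tnth (tcons p) i) =
    f ord0 p.1 * \prod_(i < d) f (lift ord0 i) (tnth p.2 i).
  case: p => x t; rewrite big_ord_recl; congr (_ * _); apply: eq_bigr => i _.
  by congr (f _ _); exact: tnthS.
rewrite integral_distribution.
- by apply: eq_integral => p _; rewrite /= tc.
- by apply/measurable_EFinP; exact: mp.
- have := integrable_tensor i0 i1; apply: eq_integrable => // p _.
  by rewrite /= tc.
Qed.

End cube_integrals.

(** * Trigonometric functions on the unit interval *)

Section trigonometric_integrals.
Context {R : realType}.

(** The fundamental theorem of calculus, in the form used to evaluate every
    one-dimensional integral below. *)
Lemma Rintegral01_derive (F f : R -> R) :
  (forall x : R, is_derive x 1 F (f x)) -> continuous f ->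
  \int[lebesgue_measure]_(x in `[0, 1]) f x = F 1 - F 0.
Proof.
move=> Ff cf.
have cF : continuous F.
  by move=> x; apply: differentiable_continuous; apply/derivable1_diffP; case: (Ff x).
rewrite /Rintegral (continuous_FTC2 (F := F)) ?ltr01//.
- exact: continuous_subspaceT.
- split.
  + by move=> x _; case: (Ff x).
  + by apply: cvg_at_right_filter; exact: cF.
  + by apply: cvg_at_left_filter; exact: cF.
- by move=> x _; rewrite derive1E; case: (Ff x).
Qed.

Lemma is_derive_mull (a x : R) : is_derive x 1 (fun y => a * y) a.
Proof.
have : is_derive x 1 (a *: (id : R -> R)) (a *: 1) by apply: is_deriveZ.
by rewrite /GRing.scale /= mulr1.
Qed.

Lemma Rintegral01_cos (a : R) : a != 0 ->
  \int[lebesgue_measure]_(x in `[0, 1]) cos (a * x) = sin a / a.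
Proof.
move=> a0.
have dF (x : R) : is_derive x 1 (fun y => a^-1 * sin (a * y)) (cos (a * x)).
  have h := is_derive1_comp (is_derive_sin (a * x)) (is_derive_mull a x).
  have h2 := is_derive1_comp (is_derive_mull a^-1 (sin (a * x))) h.
  by apply: (is_derive_eq h2); rewrite mulrC mulfK.
rewrite (Rintegral01_derive dF).
  by rewrite mulr1 mulr0 sin0 mulr0 subr0 mulrC.
by move=> x; apply: continuous_comp; [exact: mulrl_continuous|exact: continuous_cos].
Qed.

Lemma Rintegral01_sin (a : R) : a != 0 ->
  \int[lebesgue_measure]_(x in `[0, 1]) sin (a * x) = (1 - cos a) / a.
Proof.
move=> a0.
have dF (x : R) : is_derive x 1 (fun y => - a^-1 * cos (a * y)) (sin (a * x)).
  have h := is_derive1_comp (is_derive_cos (a * x)) (is_derive_mull a x).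
  have h2 := is_derive1_comp (is_derive_mull (- a^-1) (cos (a * x))) h.
  by apply: (is_derive_eq h2); rewrite mulNr mulNr mulrN opprK mulrC mulfK.
rewrite (Rintegral01_derive dF).
  by rewrite mulr1 mulr0 cos0; field.
by move=> x; apply: continuous_comp; [exact: mulrl_continuous|exact: continuous_sin].
Qed.

(** The normalized Fourier modes of frequency k + 1: cosine for [c = true],
    sine for [c = false]. *)
Definition trig (c : bool) (k : nat) (x : R) : R :=
  Num.sqrt 2 * (if c then cos (2 * pi * k.+1%:R * x) else sin (2 * pi * k.+1%:R * x)).

Let twopi_neq0 k : 2 * pi * k.+1%:R != 0 :> R.
Proof. by rewrite mulf_neq0// mulf_neq0// gt_eqF// pi_gt0. Qed.

Lemma continuous_trig c k : continuous (trig c k).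
Proof.
move=> x; rewrite /trig; apply: cvgM; first exact: cvg_cst.
case: c.
  by apply: continuous_comp; [exact: mulrl_continuous|exact: continuous_cos].
by apply: continuous_comp; [exact: mulrl_continuous|exact: continuous_sin].
Qed.

Lemma measurable_trig c k : measurable_fun [set: measurableTypeR R] (trig c k).
Proof. by apply: continuous_measurable_fun; exact: continuous_trig. Qed.

Lemma trig_le c k x : `|trig c k x| <= 2.
Proof.
rewrite normrM ger0_norm ?sqrtr_ge0//.
have s2 : Num.sqrt 2 <= 2 :> R.
  have := sqrtr_ge0 (2 : R); have : Num.sqrt 2 ^+ 2 = 2 :> R by rewrite sqr_sqrtr.
  set s := Num.sqrt _; rewrite expr2; nra.
rewrite -[leRHS]mulr1.
apply: ler_pM => //.
by case: c; rewrite ler_norml ?cos_geN1 ?cos_le1 ?sin_geN1 ?sin_le1.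
Qed.

(** The addition formula: the two modes of a frequency together reproduce a
    term of the Korobov series. *)
Lemma trigD k x y :
  trig true k x * trig true k y + trig false k x * trig false k y =
  2 * cos (2 * pi * k.+1%:R * (x - y)).
Proof.
rewrite /trig mulrBr cosB.
have s2 : Num.sqrt 2 * Num.sqrt 2 = 2 :> R by rewrite -expr2 sqr_sqrtr.
move: s2 (cos _) (cos _) (sin _) (sin _); set q := Num.sqrt _ => s2 c c' s s'.
transitivity (q * q * (c * c' + s * s')); first by ring.
by rewrite s2; ring.
Qed.

Let sin2pi2 : sin (2 * pi * 1) = 0 :> R.
Proof. by rewrite mulr1 mulrC mulr_natr sin2pi. Qed.

Let cos2pi2 : cos (2 * pi * 1) = 1 :> R.
Proof. by rewrite mulr1 mulrC mulr_natr cos2pi. Qed.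

Let continuous_integrable01 (f : R -> R) : continuous f ->
  lebesgue_measure.-integrable `[0, 1] (EFin \o f).
Proof.
move=> cf; apply: continuous_compact_integrable; first exact: segment_compact.
exact: continuous_subspaceT.
Qed.

Let continuous_cosl (a : R) : continuous (fun x => cos (a * x)).
Proof.
by move=> x; apply: continuous_comp; [exact: mulrl_continuous|exact: continuous_cos].
Qed.

Let continuous_sinl (a : R) : continuous (fun x => sin (a * x)).
Proof.
by move=> x; apply: continuous_comp; [exact: mulrl_continuous|exact: continuous_sin].
Qed.

Lemma Rintegral_trig c :
  \int[lebesgue_measure]_(x in `[0, 1]) trig c 0 x = 0.
Proof.
rewrite /trig; case: c; (rewrite RintegralZl//; last exact: continuous_integrable01).
  by rewrite Rintegral01_cos ?twopi_neq0// sin2pi2 mul0r mulr0.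
by rewrite Rintegral01_sin ?twopi_neq0// cos2pi2 subrr mul0r mulr0.
Qed.

(** The double angle formulas turn the products of modes into the constant 1 and
    the functions cos and sin of a x = 4 pi x, which integrate to 0. *)
Lemma Rintegral_trig_trig c c' :
  \int[lebesgue_measure]_(x in `[0, 1]) (trig c 0 x * trig c' 0 x) = (c == c')%:R.
Proof.
have s2 : Num.sqrt 2 * Num.sqrt 2 = 2 :> R by rewrite -expr2 sqr_sqrtr.
pose a : R := 2 * pi * 2.
have aE x : a * x = (2 * pi * 1 * x) *+ 2 by rewrite /a; ring.
have a0 : a != 0 := twopi_neq0 1.
have a1 : a = pi *+ 2 *+ 2 by rewrite /a; ring.
have sina : sin a = 0 by rewrite a1 sin_mulr2n sin2pi mulr0 mul0rn.
have cosa : cos a = 1 by rewrite a1 cos_mulr2n cos2pi expr1n; ring.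
have int1 : \int[lebesgue_measure]_(x in `[0, 1]) 1 = 1 :> R.
  rewrite (@Rintegral01_derive id (fun=> 1)) ?subr0//.
  by move=> x; exact: cvg_cst.
have i1 : lebesgue_measure.-integrable `[0, 1] (EFin \o (fun=> 1 : R)).
  by apply: continuous_integrable01 => x; exact: cvg_cst.
have icos := continuous_integrable01 (@continuous_cosl a).
have Icos : \int[lebesgue_measure]_(x in `[0, 1]) cos (a * x) = 0.
  by rewrite Rintegral01_cos// sina mul0r.
have Isin : \int[lebesgue_measure]_(x in `[0, 1]) sin (a * x) = 0.
  by rewrite Rintegral01_sin// cosa subrr mul0r.
case: c; case: c' => /=.
- transitivity (\int[lebesgue_measure]_(x in `[0, 1]) (1 + cos (a * x))).
    apply: eq_Rintegral => x _; rewrite aE cos_mulr2n /trig mulrACA s2; ring.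
  by rewrite RintegralD// int1 Icos addr0.
- transitivity (\int[lebesgue_measure]_(x in `[0, 1]) sin (a * x)) => //.
  by apply: eq_Rintegral => x _; rewrite aE sin_mulr2n /trig mulrACA s2; ring.
- transitivity (\int[lebesgue_measure]_(x in `[0, 1]) sin (a * x)) => //.
  by apply: eq_Rintegral => x _; rewrite aE sin_mulr2n /trig mulrACA s2; ring.
- transitivity (\int[lebesgue_measure]_(x in `[0, 1]) (1 - cos (a * x))).
    apply: eq_Rintegral => x _; rewrite aE cos_mulr2n /trig mulrACA s2.
    have := cos2Dsin2 (2 * pi * 1 * x); set u := cos _; set v := sin _ => uv.
    by rewrite -(mulr_natr (u ^+ 2)) -(addrK (v ^+ 2) (u ^+ 2)) uv; ring.
  by rewrite RintegralB// int1 Icos subr0.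
Qed.

End trigonometric_integrals.

(** * An orthonormal system on the cube *)

Section cube_basis.
Context {R : realType} (d : nat).
Local Notation RT := (measurableTypeR R).
Local Notation mu := (@lebesgue_cube R d).

Lemma indic_cubeE (t : d.-tuple RT) :
  \1_(cube d) t = \prod_i \1_(`[0, 1]%classic : set RT) (tnth t i) :> R.
Proof.
rewrite indicE; case: (boolP (t \in cube d)) => [|/negP] /[!inE] tc /=.
  by rewrite big1// => i _; rewrite indicE mem_set//; exact: tc.
have /existsNP[i ti] : ~ forall i, tnth t i \in `[0, 1]%R by [].
by rewrite (bigD1 i)//= indicE memNset ?mul0r//.
Qed.

Lemma measurable_cube : measurable (cube d : set (d.-tuple RT)).
Proof.
have -> : cube d = \bigcap_(i in setT) ((@tnth d RT)^~ i @^-1` `[0, 1]%classic).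
  by apply/seteqP; split => [t tc i _|t tc i]; [exact: tc | exact: (tc i)].
apply: fin_bigcap_measurable => // i _.
by rewrite -[X in measurable X]setTI; exact: measurable_tnth.
Qed.

Lemma Rintegral_cube_indic (f : 'I_d -> RT -> R) (C : R) :
    (forall i, measurable_fun setT (f i)) -> (forall i x, `|f i x| <= C) ->
  \int[mu]_t (\1_(cube d) t * \prod_i f i (tnth t i)) =
  \prod_i \int[lebesgue_measure]_(x in `[0, 1]) f i x.
Proof.
move=> mf fC.
pose I01 : set RT := `[0, 1]%classic.
have mI : measurable I01 by exact: measurable_itv.
pose h i x := \1_I01 x * f i x.
have mh i : measurable_fun setT (h i).
  by apply: measurable_funM => //; exact: measurable_indic.
have hC i x : `|h i x| <= C.
  rewrite normrM; apply: le_trans (fC i x); rewrite ler_piMl//.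
  by rewrite indicE; case: (_ \in _); rewrite ?normr1 ?normr0.
under eq_Rintegral do rewrite indic_cubeE -big_split/=.
rewrite (Rintegral_cube_prod mh hC); apply: eq_bigr => i _.
rewrite (integral_lebesgue_unit (mh i) (hC i)); apply: eq_Rintegral => x xI.
by rewrite /h indicE xI mul1r.
Qed.

(** A product of two one-variable functions is a product over all the coordinates
    whose other factors are 1; the coordinates i and j share a factor when
    they coincide. *)
Lemma Rintegral_cube2 (f g : RT -> R) (C : R) (i j : 'I_d) :
    measurable_fun setT f -> measurable_fun setT g ->
    (forall x, `|f x| <= C) -> (forall x, `|g x| <= C) ->
  \int[mu]_t (\1_(cube d) t * (f (tnth t i) * g (tnth t j))) =
  if i == j then \int[lebesgue_measure]_(x in `[0, 1]) (f x * g x)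
  else (\int[lebesgue_measure]_(x in `[0, 1]) f x) *
       (\int[lebesgue_measure]_(x in `[0, 1]) g x).
Proof.
move=> mf mg fC gC.
have C0 : 0 <= C by rewrite (le_trans _ (fC 0)).
pose F k x := (if k == i then f x else 1) * (if k == j then g x else 1).
have mF k : measurable_fun setT (F k).
  by apply: measurable_funM; case: eqP.
have bound (b : bool) (h : RT -> R) x : (forall x, `|h x| <= C) ->
    `|if b then h x else 1| <= C + 1.
  move=> hC; case: b; last by rewrite normr1 lerDr.
  by rewrite (le_trans (hC x))// lerDl.
have FC k x : `|F k x| <= (C + 1) * (C + 1).
  by rewrite normrM; apply: ler_pM => //; exact: bound.
have prodE (k0 : 'I_d) (h : 'I_d -> R) : \prod_k (if k == k0 then h k else 1) = h k0.
  by rewrite -big_mkcond big_pred1_eq.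
transitivity (\int[mu]_t (\1_(cube d) t * \prod_k F k (tnth t k))).
  apply: eq_Rintegral => t _; congr (_ * _).
  by rewrite big_split/= (prodE i (fun k => f (tnth t k)))
    (prodE j (fun k => g (tnth t k))).
rewrite (Rintegral_cube_indic mF FC).
have int1 : \int[lebesgue_measure]_(x in `[0, 1]) 1 = 1 :> R.
  rewrite (@Rintegral01_derive _ id (fun=> 1)) ?subr0//.
  by move=> x; exact: cvg_cst.
have FE k : \int[lebesgue_measure]_(x in `[0, 1]) F k x =
    if k == i then if k == j then \int[lebesgue_measure]_(x in `[0, 1]) (f x * g x)
      else \int[lebesgue_measure]_(x in `[0, 1]) f x
    else if k == j then \int[lebesgue_measure]_(x in `[0, 1]) g x else 1.
  rewrite /F; case: (k == i); case: (k == j) => //=.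
  - by under eq_Rintegral do rewrite mulr1.
  - by under eq_Rintegral do rewrite mul1r.
  - by under eq_Rintegral do rewrite mul1r.
rewrite (bigD1 i)//= FE eqxx; case: (eqVneq i j) => [ij|ij].
  by rewrite big1 ?mulr1// => k /negbTE ki; rewrite FE -ij ki.
rewrite (bigD1 j) 1?eq_sym//= FE eq_sym (negbTE ij) eqxx big1 ?mulr1//.
by move=> k /andP[/negbTE ki /negbTE kj]; rewrite FE ki kj.
Qed.

(** The functions of the system carry the indicator of the cube: the field is
    only specified there, while the measure lives on the whole space. *)
Definition cube_one : d.-tuple RT -> R := \1_(cube d).

Definition cube_trig (j : 'I_d) (c : bool) (k : nat) (t : d.-tuple RT) : R :=
  \1_(cube d) t * trig c k (tnth t j).

Lemma cube_one_L2 : cube_one \in Lfun mu 2%:E.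
Proof.
apply: (@bounded_L2 _ _ _ _ _ 1); first exact: (measurable_indic measurable_cube).
by move=> t; rewrite /cube_one indicE; case: (_ \in _); rewrite ?normr1 ?normr0.
Qed.

Lemma cube_trig_L2 j c k : cube_trig j c k \in Lfun mu 2%:E.
Proof.
apply: (@bounded_L2 _ _ _ _ _ 2).
  apply: measurable_funM; first exact: (measurable_indic measurable_cube).
  by apply: (measurableT_comp (measurable_trig c k)); exact: measurable_tnth.
move=> t; rewrite normrM; apply: le_trans (trig_le c k (tnth t j)).
by rewrite ler_piMl// indicE; case: (_ \in _); rewrite ?normr1 ?normr0.
Qed.

Let indic_mul (t : d.-tuple RT) (a b : R) :
  \1_(cube d) t * a * (\1_(cube d) t * b) = \1_(cube d) t * (a * b).
Proof. by rewrite mulrACA indicE; case: (_ \in _); rewrite ?mul1r ?mul0r. Qed.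

Lemma dot_cube_one : dot mu cube_one cube_one = 1.
Proof.
pose f (i : 'I_d) (x : RT) : R := 1.
transitivity (\int[mu]_t (\1_(cube d) t * \prod_i f i (tnth t i))).
  apply: eq_Rintegral => t _; rewrite big1// mulr1 /cube_one indicE.
  by case: (_ \in _); rewrite ?mulr1 ?mulr0.
rewrite (@Rintegral_cube_indic _ 1)//; last 2 first.
- by move=> i; exact: measurable_cst.
- by move=> i x; rewrite normr1.
rewrite big1// => i _; rewrite (@Rintegral01_derive _ id (fun=> 1)) ?subr0//.
by move=> x; exact: cvg_cst.
Qed.

Lemma dot_cube_one_trig j c : dot mu cube_one (cube_trig j c 0) = 0.
Proof.
transitivity (\int[mu]_t (\1_(cube d) t * (cst 1 (tnth t j) * trig c 0 (tnth t j)))).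
  apply: eq_Rintegral => t _; rewrite /cube_one /cube_trig mul1r mulrA indicE.
  by case: (_ \in _); rewrite ?mulr1 ?mulr0.
rewrite (@Rintegral_cube2 _ _ 2)//; last 3 first.
- exact: measurable_trig.
- by move=> x; rewrite normr1 ler1n.
- exact: trig_le.
by rewrite eqxx; under eq_Rintegral do rewrite mul1r; rewrite Rintegral_trig.
Qed.

Lemma dot_cube_trig j c j' c' :
  dot mu (cube_trig j c 0) (cube_trig j' c' 0) = ((j, c) == (j', c'))%:R.
Proof.
transitivity (\int[mu]_t (\1_(cube d) t * (trig c 0 (tnth t j) * trig c' 0 (tnth t j')))).
  by apply: eq_Rintegral => t _; rewrite /cube_trig indic_mul.
rewrite (@Rintegral_cube2 _ _ 2)//; try exact: measurable_trig; try exact: trig_le.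
rewrite xpair_eqE; case: eqVneq => _ /=; first exact: Rintegral_trig_trig.
by rewrite !Rintegral_trig mul0r.
Qed.

End cube_basis.

(** * Tails of the zeta series *)

Section zeta.
Context {R : realType}.

(** Term by term comparison: every finite block of the tail of [u] is bounded by the
    same block of the tail of [a]. *)
Lemma series_tail (u a : R^nat) : (forall k, `|u k| <= a k) ->
  cvgn (series a) ->
  cvgn (series u) /\
  forall n, `|limn (series u) - series u n| <= limn (series a) - series a n.
Proof.
move=> ua ca.
have cu : cvgn (series u).
  apply: normed_cvg; apply: series_le_cvg ca => // k.
  - exact: normr_ge0.
  - exact: le_trans (ua k).
split=> // n.
have h1 : (fun N => `|series u N - series u n|) @ \oo --> `|limn (series u) - series u n|.
  by apply: cvg_norm; apply: cvgB => //; exact: cvg_cst.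
have h2 : (fun N => series a N - series a n) @ \oo --> limn (series a) - series a n.
  by apply: cvgB => //; exact: cvg_cst.
apply: (ler_cvg_to h1 h2); near=> N.
have nN : (n <= N)%N by near: N; exact: nbhs_infty_ge.
rewrite !sub_series_geq//; apply: le_trans (ler_norm_sum _ _ _) _.
exact: ler_sum.
Unshelve. all: by end_near.
Qed.

Definition pterm (s : R) (k : nat) : R := k.+1%:R `^ (- s).
Definition zeta (s : R) : R := limn (series (pterm s)).

Lemma pterm_gt0 s k : 0 < pterm s k.
Proof. exact: powR_gt0. Qed.

(** By the mean value theorem, the decrease of x^(1 - s) between k + 1 and k + 2 is
    (s - 1) x^(- s) at an intermediate point, which exceeds (s - 1) (k + 2)^(- s).
    The right side telescopes, which gives the convergence of the zeta series. *)
Lemma pterm_telescope s k : 1 < s ->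
  pterm s k.+1 <= (pterm (s - 1) k - pterm (s - 1) k.+1) / (s - 1).
Proof.
move=> s1; have s10 : 0 < s - 1 by rewrite subr_gt0.
have pos (x : R) : k.+1%:R <= x -> 0 < x by apply: lt_le_trans.
have ltk : k.+1%:R < k.+2%:R :> R by rewrite ltr_nat.
have dp (x : R) : x \in `]k.+1%:R, k.+2%:R[ ->
    is_derive x 1 (powR (R:=R) ^~ (- (s - 1))) (- (s - 1) * x `^ (- (s - 1) - 1)).
  by rewrite in_itv/= => /andP[/ltW /pos x0 _]; exact: is_derive1_powR.
have [|x] := MVT ltk dp.
  apply: derivable_within_continuous => x; rewrite in_itv/= => /andP[/pos x0 _].
  by have [] := is_derive1_powR (- (s - 1)) x0.
rewrite in_itv/= => /andP[kx xk].
rewrite -(natrB _ (leqnSn _)) subSnn mulr1 => E.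
have {E} E : pterm (s - 1) k - pterm (s - 1) k.+1 = x `^ (- s) * (s - 1).
  rewrite /pterm -[LHS]opprB E mulNr opprK mulrC.
  by congr (_ `^ _ * _); ring.
rewrite E mulfK ?gt_eqF// /pterm.
have x0 : 0 < x by apply: pos; exact: ltW.
rewrite !powRN lef_pV2 ?posrE ?powR_gt0//.
apply: ge0_ler_powR; rewrite ?nnegrE ?ltW//; lra.
Qed.

Lemma is_cvg_zeta s : 1 < s -> cvgn (series (pterm s)).
Proof.
move=> s1; apply: nondecreasing_is_cvgn.
  by apply: nondecreasing_series => k _ _; exact/ltW/pterm_gt0.
have s10 : 0 < s - 1 by rewrite subr_gt0.
have partial n : series (pterm s) n.+1 <= 1 + (1 - pterm (s - 1) n) / (s - 1).
  elim: n => [|n ih].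
    by rewrite /series/= big_nat1 /pterm powR1/= subrr mul0r addr0.
  rewrite seriesSr; apply: le_trans (lerD ih (pterm_telescope n s1)) _.
  by rewrite -addrA -mulrDl addrA subrK.
exists (1 + (s - 1)^-1) => _ [n _ <-].
apply: (@le_trans _ _ (series (pterm s) n.+1)).
  by rewrite seriesSr lerDl ltW// pterm_gt0.
apply: le_trans (partial n) _.
rewrite lerD2l; apply: ler_piMl; first by rewrite invr_ge0 ltW.
by rewrite gerBl ltW ?pterm_gt0.
Qed.

Lemma zeta_ge1 s : 1 < s -> 1 <= zeta s.
Proof.
move=> s1; have := nondecreasing_cvgn_le _ (is_cvg_zeta s1) 1.
by rewrite /series/= big_nat1 /pterm powR1/=; apply; apply: nondecreasing_series => k _ _;
  exact/ltW/pterm_gt0.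
Qed.

(** For k >= 2, k^(- s) = k^(2 - s) k^(- 2) <= 2^(2 - s) k^(- 2). *)
Lemma zeta_le s : 2 <= s -> zeta s <= 1 + 2 `^ (2 - s) * zeta 2.
Proof.
move=> s2; have s1 : 1 < s by lra.
have pge0 t k : 0 <= pterm t k by exact/ltW/pterm_gt0.
have hub n : series (pterm s) n <= 1 + 2 `^ (2 - s) * zeta 2.
  apply: (@le_trans _ _ (1 + 2 `^ (2 - s) * series (pterm 2) n)); last first.
    rewrite lerD2l ler_wpM2l ?powR_ge0//.
    apply: nondecreasing_cvgn_le; first by apply: nondecreasing_series => k _ _.
    by apply: is_cvg_zeta; lra.
  elim: n => [|n ih]; first by rewrite /series/= !big_geq// mulr0 addr0.
  case: n ih => [_|n ih].
    by rewrite /series/= !big_nat1 {1}/pterm powR1/= lerDl mulr_ge0// powR_ge0.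
  rewrite seriesSr [X in 1 + _ * X]seriesSr mulrDr addrA lerD//.
  have -> : pterm s n.+1 = n.+2%:R `^ (2 - s) * pterm 2 n.+1.
    by rewrite /pterm -powRD ?pnatr_eq0 ?implybT//; congr (_ `^ _); ring.
  rewrite ler_wpM2r ?pge0//.
  rewrite -(opprB s 2) !powRN lef_pV2 ?posrE ?powR_gt0//.
  by apply: ge0_ler_powR; rewrite ?nnegrE ?ler_nat//; lra.
apply: limr_le; first exact: is_cvg_zeta.
exact: nearW.
Qed.

Lemma zeta_cvg1 (s : R^nat) : s j @[j --> \oo] --> +oo ->
  zeta (s j) @[j --> \oo] --> (1 : R).
Proof.
move=> sy.
have p0 : 2 `^ (2 - s j) @[j --> \oo] --> (0 : R).
  apply/cvgrPdist_lt => e e0.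
  have [n _ /(_ n (leqnn _)) ne] := near_infty_natSinv_expn_lt (PosNum e0).
  near=> j; rewrite sub0r normrN ger0_norm ?powR_ge0//.
  apply: le_lt_trans ne.
  rewrite div1r -powR_mulrn// -powRN ler_powR ?ler1n//.
  have sj : n%:R + 2 <= s j by near: j; move/cvgryPge : sy; exact.
  by rewrite lerBlDr -lerBlDl opprK addrC.
have h : 1 + 2 `^ (2 - s j) * zeta 2 @[j --> \oo] --> (1 : R).
  by rewrite -[X in _ --> X]addr0 -[X in _ + X](mul0r (zeta 2));
    apply: cvgD; [exact: cvg_cst|apply: cvgM p0 _; exact: cvg_cst].
apply: (@squeeze_cvgr _ _ _ _ (fun=> 1) _ _ _ _ _ h); last exact: cvg_cst.
near=> j.
have s2 : 2 <= s j by near: j; move/cvgryPge : sy; exact.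
by rewrite zeta_le// zeta_ge1//; lra.
Unshelve. all: by end_near.
Qed.

End zeta.

(** * Korobov kernels and their sums over the coordinates *)

Section korobov_kernel.
Context {R : realType}.

Lemma korobov_diag (alpha beta sigma t : R) :
  korobov alpha beta sigma t t = alpha + 2 * beta * zeta sigma.
Proof.
rewrite /korobov (_ : (fun k => _) = pterm sigma)//.
by apply/funext => k; rewrite subrr mulr0 cos0 mulr1.
Qed.

(** The truncation of the series at order [n], uniformly in t and s: the tail of the
    cosine series is dominated by the tail of the zeta series. *)
Lemma korobov_approx (alpha beta sigma t s : R) n : 1 < sigma -> 0 <= beta ->
  `|korobov alpha beta sigma t s -
    (alpha + \sum_(k < n) beta * pterm sigma k *
       (trig true k t * trig true k s + trig false k t * trig false k s))| <=
  2 * beta * (zeta sigma - series (pterm sigma) n).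
Proof.
move=> s1 b0.
pose u k := pterm sigma k * cos (2 * pi * k.+1%:R * (t - s)).
have up k : `|u k| <= pterm sigma k.
  rewrite normrM ger0_norm ?ler_piMr ?(ltW (pterm_gt0 _ _))//.
  by rewrite ler_norml cos_geN1 cos_le1.
have [cu tailu] := series_tail up (is_cvg_zeta s1).
have -> : korobov alpha beta sigma t s = alpha + 2 * beta * limn (series u) by [].
have -> : \sum_(k < n) beta * pterm sigma k *
    (trig true k t * trig true k s + trig false k t * trig false k s) =
    2 * beta * series u n.
  rewrite /series/= big_mkord mulr_sumr; apply: eq_bigr => k _.
  by rewrite trigD /u; ring.
rewrite opprD addrACA subrr add0r -mulrBr normrM ger0_norm ?mulr_ge0//.
by apply: ler_wpM2l; rewrite ?mulr_ge0//; exact: tailu.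
Qed.

End korobov_kernel.

Section additive_kernel.
Context {R : realType} (d : nat).
Local Notation RT := (measurableTypeR R).
Local Notation mu := (@lebesgue_cube R d).
Variables alpha beta sigma : 'I_d -> R.
Hypotheses (alpha_gt0 : forall i, 0 < alpha i) (beta_gt0 : forall i, 0 < beta i)
  (sigma_gt1 : forall i, 1 < sigma i).

Let sum_unit (F : unit -> R) : \sum_i F i = F tt.
Proof. by rewrite (bigD1 tt)//= big1 ?addr0//; case. Qed.

Definition cube_kernel (t s : d.-tuple RT) : R :=
  \1_(cube d) t * \1_(cube d) s *
  \sum_i korobov (alpha i) (beta i) (sigma i) (tnth t i) (tnth s i).

(** The modes are indexed by [unit + 'I_d * bool]: the constant function, then
    the cosine and the sine of frequency 1 of each coordinate. The higher
    frequencies, whose eigenvalues become negligible, are left out. *)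
Definition cube_eigenfun (i : unit + 'I_d * bool) : d.-tuple RT -> R :=
  match i with inl _ => @cube_one R d | inr (j, c) => cube_trig j c 0 end.

Definition cube_eigenval (i : unit + 'I_d * bool) : R :=
  match i with inl _ => \sum_j alpha j | inr (j, _) => beta j end.

Definition total_variance : R := \sum_i (alpha i + 2 * beta i * zeta (sigma i)).

Lemma cube_kernel_diag t : cube_kernel t t = total_variance * (cube_one t * cube_one t).
Proof.
rewrite /cube_kernel mulrC; congr (_ * _).
by apply: eq_bigr => i _; rewrite korobov_diag.
Qed.

Lemma cube_eigenfun_orthonormal : orthonormal mu cube_eigenfun.
Proof.
split=> [[[]|[j c]]|[[]|[j c]] [[]|[j' c']]] /=.
- exact: cube_one_L2.
- exact: cube_trig_L2.
- by rewrite dot_cube_one.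
- by rewrite dot_cube_one_trig.
- by rewrite dotC dot_cube_one_trig.
- by rewrite dot_cube_trig.
Qed.

(** Truncate every Korobov series at a common large order and split each
    term by [trigD]: the kernel becomes, up to [delta], a sum of squares
    containing the modes of [cube_eigenfun] with their eigenvalues. The remaining
    squares, of higher frequency, are dropped from the last inequality. *)
Lemma cube_kernel_approx (delta : R) : 0 < delta ->
  exists (J : finType) (h : J -> d.-tuple RT -> R),
    [/\ forall j, h j \in Lfun mu 2%:E,
        forall t s, `|cube_kernel t s - \sum_j h j t * h j s| <= delta &
        forall g, g \in Lfun mu 2%:E ->
          \sum_i cube_eigenval i * dot mu (cube_eigenfun i) g ^+ 2 <=
          \sum_j dot mu (h j) g ^+ 2].
Proof.
move=> delta0.
have [n tail] : exists n, \sum_i 2 * beta i * (zeta (sigma i) -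
    series (pterm (sigma i)) n.+1) <= delta.
  have : \sum_i 2 * beta i * (zeta (sigma i) - series (pterm (sigma i)) n.+1)
      @[n --> \oo] --> \sum_(i < d) 2 * beta i * (zeta (sigma i) - zeta (sigma i)).
    apply: (cvg_big add_continuous) => i _.
    apply: cvgM; first exact: cvg_cst.
    apply: cvgB; first exact: cvg_cst.
    by rewrite (cvg_shiftS (series (pterm (sigma i)))); exact: is_cvg_zeta.
  rewrite [X in _ --> X]big1; last by move=> i _; rewrite subrr mulr0.
  move=> /cvgrPdist_le /(_ _ delta0)[n _ /(_ n (leqnn _)) /= H]; exists n.
  by rewrite sub0r normrN in H; exact: le_trans (ler_norm _) H.
pose h (j : unit + 'I_d * bool * 'I_n.+1) := match j return d.-tuple RT -> R with
  | inl _ => fun t => Num.sqrt (\sum_i alpha i) * cube_one t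
  | inr (j, c, k) => fun t =>
      Num.sqrt (beta j * pterm (sigma j) k) * cube_trig j c k t end.
have A0 : 0 <= \sum_i alpha i by apply: sumr_ge0 => i _; exact: ltW.
have bp0 j k : 0 <= beta j * pterm (sigma j) k.
  by apply: mulr_ge0; apply: ltW => //; exact: pterm_gt0.
exists (unit + 'I_d * bool * 'I_n.+1)%type, h; split.
- move=> [[]|[[j c] k]] /=; apply: L2_scale; first exact: cube_one_L2.
  exact: cube_trig_L2.
- move=> t s.
  pose D i := korobov (alpha i) (beta i) (sigma i) (tnth t i) (tnth s i) -
    (alpha i + \sum_(k < n.+1) beta i * pterm (sigma i) k *
      (trig true k (tnth t i) * trig true k (tnth s i) +
       trig false k (tnth t i) * trig false k (tnth s i))).
  have -> : cube_kernel t s - \sum_j h j t * h j s =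
      \1_(cube d) t * \1_(cube d) s * \sum_i D i.
    rewrite sumrB mulrBr; congr (_ - _).
    rewrite big_sumType sum_unit/= mulrACA -expr2 sqr_sqrtr//.
    rewrite big_split/= mulrDr [X in X + _]mulrC; congr (_ + _).
    transitivity (\sum_j \sum_c \sum_k
        h (inr (j, c, k)) t * h (inr (j, c, k)) s).
      by rewrite pair_bigA pair_bigA/=; apply: eq_bigr => -[[j c] k].
    rewrite mulr_sumr; apply: eq_bigr => j _.
    rewrite big_bool/= -big_split mulr_sumr; apply: eq_bigr => k _ /=.
    have : Num.sqrt (beta j * pterm (sigma j) k) ^+ 2 = beta j * pterm (sigma j) k.
      by rewrite sqr_sqrtr.
    set q := Num.sqrt _ => <-; rewrite /cube_trig; ring.
  rewrite normrM; apply: le_trans tail.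
  apply: (@le_trans _ _ (1 * `|\sum_i D i|)).
    by apply: ler_wpM2r => //; rewrite !indicE; do 2 case: (_ \in _);
      rewrite ?mulr0 ?mulr1 ?normr1 ?normr0.
  rewrite mul1r; apply: le_trans (ler_norm_sum _ _ _) _.
  by apply: ler_sum => i _; apply: korobov_approx => //; exact: ltW.
- move=> g gL; rewrite !big_sumType/= !sum_unit /=.
  have dotZ a f : f \in Lfun mu 2%:E ->
      dot mu (fun t => a * f t) g = a * dot mu f g.
    move=> fL; have := dot_linearl a fL (L2_cst mu 0) gL.
    by rewrite dot0l addr0; under eq_fun do rewrite addr0.
  rewrite dotZ ?cube_one_L2// exprMn sqr_sqrtr// lerD2l.
  rewrite [leRHS](_ : _ = \sum_p \sum_k dot mu (h (inr (p, k))) g ^+ 2); last first.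
    by rewrite pair_bigA /=; apply: eq_bigr => -[[j c] k].
  apply: ler_sum => -[j c] _; rewrite big_ord_recl /= dotZ ?cube_trig_L2//.
  rewrite exprMn sqr_sqrtr// /pterm powR1 mulr1 lerDl.
  by apply: sumr_ge0 => k _; rewrite sqr_ge0.
Qed.

End additive_kernel.

(** * Complexity of an additive field in fixed dimension *)

Lemma sum_modes (W : nmodType) (I : finType) (F : unit + I * bool -> W) :
  \sum_i F i = F (inl tt) + \sum_i (F (inr (i, true)) + F (inr (i, false))).
Proof.
rewrite big_sumType/= (bigD1 tt)//= [X in _ + X + _]big1 ?addr0; last by case.
congr (_ + _); transitivity (\sum_i \sum_c F (inr (i, c))).
  by rewrite pair_bigA; apply: eq_bigr => -[i c].
by apply: eq_bigr => i _; rewrite big_bool.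
Qed.

Section additive_field.
Context {R : realType} {dO : measure_display} {Omega : measurableType dO}.
Variables (P : probability Omega R) (d : nat).
Local Notation RT := (measurableTypeR R).
Local Notation point := (d.-tuple RT).
Local Notation mu := (@lebesgue_cube R d).
Variables alpha beta sigma : 'I_d -> R.
Hypotheses (alpha_gt0 : forall i, 0 < alpha i) (beta_gt0 : forall i, 0 < beta i)
  (sigma_gt1 : forall i, 1 < sigma i).
Variable X : point -> Omega -> R.
Hypothesis X0 : zero_mean_random_field P X.
Hypothesis XK : has_covariance_function P (cube d) X (fun t s =>
  (\sum_i korobov (alpha i) (beta i) (sigma i) (tnth t i) (tnth s i))%:E).

Local Notation K := (cube_kernel alpha beta sigma).
Local Notation V := (total_variance alpha beta sigma).

(** The field set to 0 outside the cube, so that its moments are known at all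
    points of the space that carries the measure. *)
Let Z (p : Omega * point) : R := \1_(cube d) p.2 * X p.2 p.1.

Let measurable_Z : measurable_fun setT Z.
Proof.
have [[mX _] _] := X0.
have mD : measurable ([set: Omega] `*` (cube d : set point)).
  by apply: measurableX => //; exact: measurable_cube.
have -> : Z = (fun p => X p.2 p.1) \_ ([set: Omega] `*` cube d).
  apply/funext => -[w t]; rewrite /Z patchE indicE /=.
  have -> : ((w, t) \in [set: Omega] `*` cube d) = (t \in cube d).
    by apply/idP/idP; rewrite !inE; [case|split].
  by case: ifP => _; rewrite ?mul1r ?mul0r.
exact/(measurable_restrictT _ mD).
Qed.

Let Z_cov t s : (\int[P]_w (Z (w, t) * Z (w, s))%:E)%E = (K t s)%:E.
Proof.
rewrite /Z /cube_kernel !indicE /=.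
have [tc|_] := boolP (t \in cube d); last first.
  by rewrite !mul0r; under eq_integral do rewrite !mul0r; rewrite integral0.
have [sc|_] := boolP (s \in cube d); last first.
  rewrite !(mulr0, mul0r); under eq_integral do rewrite !(mul0r, mulr0).
  by rewrite integral0.
rewrite !inE in tc sc.
have [_ X0'] := X0; have [tL tE] := X0' _ tc; have [sL sE] := X0' _ sc.
rewrite !mul1r -(XK tc sc) covarianceE.
- rewrite tE mul0e sube0 unlock; apply: eq_integral => w _.
  by rewrite !mul1r.
- by apply: (Lfun_subset12 _ tL); rewrite fin_num_measure.
- by apply: (Lfun_subset12 _ sL); rewrite fin_num_measure.
- exact: Lfun2_mul_Lfun1.
Qed.

Let V_ge0 : 0 <= V.
Proof.
apply: sumr_ge0 => i _; apply: addr_ge0; first exact: ltW.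
apply: mulr_ge0; first by rewrite mulr_ge0// ltW.
exact: le_trans ler01 (zeta_ge1 (sigma_gt1 i)).
Qed.

Let KV t : K t t <= V.
Proof.
rewrite cube_kernel_diag ler_piMr// /cube_one indicE.
by case: (_ \in _); rewrite ?mul0r ?mul1r.
Qed.

Let sqnormE (f : point -> R) :
  sqnormL2 f = (\int[mu]_t ((\1_(cube d) t * f t) ^+ 2)%:E)%E.
Proof.
rewrite /sqnormL2 integral_mkcond; apply: eq_integral => t _.
rewrite patchE indicE; case: ifP => _; first by rewrite mul1r.
by rewrite mul0r expr0n.
Qed.

Let dotE w (psi : point -> R) :
  dotL2 (X ^~ w) psi = coef mu Z (fun t => \1_(cube d) t * psi t) w.
Proof.
rewrite /dotL2 Rintegral_mkcond; apply: eq_Rintegral => t _.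
rewrite patchE /Z indicE; case: ifP => _; first by rewrite !mul1r.
by rewrite !mul0r.
Qed.

Let residualE n (psi : 'I_n -> point -> R) w :
  sqnormL2 (fun t => X t w - \sum_(m < n) dotL2 (X ^~ w) (psi m) * psi m t) =
  (\int[mu]_t ((Z (w, t) - \sum_(m < n)
     coef mu Z (fun t => \1_(cube d) t * psi m t) w * (\1_(cube d) t * psi m t)) ^+ 2)%:E)%E.
Proof.
rewrite sqnormE; apply: eq_integral => t _; congr (_ ^+ 2)%:E.
rewrite mulrBr mulr_sumr; congr (_ - _); apply: eq_bigr => m _.
by rewrite dotE; ring.
Qed.

Lemma approx_error0 : approx_error P X 0 = (Num.sqrt V)%:E.
Proof.
rewrite /= /rms_norm.
have -> : (\int[P]_w sqnormL2 (X ^~ w))%E = V%:E; last by [].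
under eq_integral do rewrite sqnormE.
rewrite (integral_sqr_field mu measurable_Z Z_cov).
under eq_integral do rewrite cube_kernel_diag EFinM.
rewrite integralZl//; last exact: L2_mul_integrable (cube_one_L2 d) (cube_one_L2 d).
by rewrite (integral_dot (cube_one_L2 d) (cube_one_L2 d)) dot_cube_one mule1.
Qed.

Lemma approx_errorS n : (0 < n)%N ->
  approx_error P X n = ereal_inf [set rms_norm P (fun t w => X t w - Y t w) |
                  Y in approximants X n].
Proof. by case: n. Qed.

Let indic_L2 psi : psi \in Lfun mu 2%:E ->
  (fun t => \1_(cube d) t * psi t) \in Lfun mu 2%:E.
Proof.
move=> /L2P[mpsi psi2]; apply/L2P; split.
  by apply: measurable_funM => //; exact: (measurable_indic (@measurable_cube R d)).
apply: le_lt_trans psi2; apply: ge0_le_integral => //.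
- by move=> t _; rewrite lee_fin sqr_ge0.
- apply/measurable_EFinP/measurable_funX/measurable_funM => //.
  exact: (measurable_indic (@measurable_cube R d)).
- by apply/measurable_EFinP/measurable_funX.
move=> t _; rewrite lee_fin exprMn ler_piMl ?sqr_ge0// indicE.
Qed.

Let eigen_indic i t : \1_(cube d) t * cube_eigenfun i t = cube_eigenfun i t :> R.
Proof.
case: i => [[]|[j c]]; rewrite /= /cube_one /cube_trig ?mulrA indicE;
  by case: (_ \in _); rewrite ?mul1r ?mul0r.
Qed.

(** [residual_ge] with the weight u_j on both modes of coordinate j and 0 on
    the constant function, a single mode of no asymptotic weight. *)
Lemma approx_error_ge n (u : 'I_d -> R) (theta : R) : (0 < n)%N -> 0 <= theta ->
    (forall i, 0 <= u i <= theta) -> (forall i, u i <= beta i) ->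
  ((Num.sqrt (2 * \sum_i u i - theta * n%:R))%:E <= approx_error P X n)%E.
Proof.
move=> n0 theta0 u0 ub; rewrite approx_errorS//; apply/ereal_infP.
move=> _ [_ [psi [psiL ->]] <-]; rewrite /rms_norm.
under eq_integral do rewrite residualE.
rewrite -[X in (X <= _)%E]/(sqrte (2 * \sum_i u i - theta * n%:R)%:E).
rewrite lee_sqrt; last first.
  apply: integral_ge0 => w _; apply: integral_ge0 => t _.
  by rewrite lee_fin sqr_ge0.
pose u' (i : unit + 'I_d * bool) := if i is inr (j, _) then u j else 0.
have -> : 2 * \sum_i u i = \sum_i u' i.
  rewrite sum_modes add0r mulr_sumr; apply: eq_bigr => j _ /=; ring.
apply: (residual_ge (mu := mu) measurable_Z Z_cov KV (@cube_eigenfun_orthonormal R d)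
  (cube_kernel_approx alpha_gt0 beta_gt0 sigma_gt1)
  (psi := fun m t => \1_(cube d) t * psi m t)) => //.
- by move=> m; exact: indic_L2.
- by move=> [[]|[j c]] //=; rewrite lexx.
- by move=> [[]|[j c]] //=; apply: sumr_ge0 => i _; exact: ltW.
Qed.

(** Project on the constant function and on the cosine and sine of every
    coordinate in [S], that is, on 2 |S| + 1 functions. *)
Lemma approx_error_le (S : {set 'I_d}) :
  (approx_error P X (2 * #|S|).+1 <=
   (Num.sqrt (V - (\sum_i alpha i + 2 * \sum_(i in S) beta i)))%:E)%E.
Proof.
pose S' : {set unit + 'I_d * bool} :=
  [set i | if i is inr (j, _) then j \in S else true]%SET.
have cardS' : (2 * #|S|).+1 = #|S'|.
  have -> : #|S'| = (\sum_j ((j \in S) + (j \in S))).+1.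
    rewrite -sum1_card big_mkcond; apply: etrans (@sum_modes nat _ _) _.
    rewrite inE; apply: (congr1 succn); apply: eq_bigr => j _.
    by rewrite !inE; case: (j \in S).
  rewrite -sum1_card big_mkcond big_distrr/=; congr _.+1.
  by apply: eq_bigr => j _; case: (j \in S).
have sumS' : \sum_i alpha i + 2 * \sum_(i in S) beta i =
    \sum_(i in S') cube_eigenval alpha beta i.
  rewrite [RHS]big_mkcond sum_modes inE /= mulr_sumr; congr (_ + _).
  rewrite big_mkcond.
  by apply: eq_bigr => j _; rewrite !inE; case: (j \in S); ring.
rewrite cardS' sumS' approx_errorS -?cardS'// cardS'.
pose Y (t : point) w := \sum_(m < #|S'|)
  dotL2 (X ^~ w) (cube_eigenfun (enum_val m)) * cube_eigenfun (enum_val m) t.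
apply: (@le_trans _ _ (rms_norm P (fun t w => X t w - Y t w))).
  apply: ereal_inf_lbound; exists Y => //.
  exists (fun m => cube_eigenfun (enum_val m)); split => // m.
  by case: (@cube_eigenfun_orthonormal R d) => + _; exact.
rewrite /rms_norm; under eq_integral do rewrite residualE.
have h := residual_le (mu := mu) measurable_Z Z_cov KV (@cube_eigenfun_orthonormal R d)
  (cube_kernel_approx alpha_gt0 beta_gt0 sigma_gt1) S'.
apply: (@le_trans _ _ (sqrte (V - \sum_(i in S') cube_eigenval alpha beta i)%:E)) => //.
rewrite lee_sqrt.
  apply: le_trans h; rewrite le_eqVlt; apply/orP; left; apply/eqP.
  apply: eq_integral => w _; apply: eq_integral => t _; congr ((_ - _) ^+ 2)%:E.
  apply: eq_bigr => m _; rewrite eigen_indic; congr (coef _ _ _ _ * _).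
  by apply/funext => s; rewrite eigen_indic.
apply: le_trans h; apply: integral_ge0 => w _; apply: integral_ge0 => t _.
by rewrite lee_fin sqr_ge0.
Qed.

(** The projection on the modes of [S] meets the error tolerance, so the
    complexity is a true minimum, attained at some n >= 1; the lower bound on the
    error then holds at that n. *)
Lemma complexity_bounds (eps : R) (S : {set 'I_d}) : 0 < eps ->
    V - (\sum_i alpha i + 2 * \sum_(i in S) beta i) <= eps ^+ 2 * V ->
  (approx_complexity P X eps <= (2 * #|S|).+1)%N /\
  forall (u : 'I_d -> R) theta, 0 <= theta ->
    (forall i, 0 <= u i <= theta) -> (forall i, u i <= beta i) ->
    2 * \sum_i u i - theta * (approx_complexity P X eps)%:R <= eps ^+ 2 * V.
Proof.
move=> eps0 epsS.
pose ok n := (0 < n)%N /\ (approx_error P X n <= eps%:E * approx_error P X 0)%E.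
have eps_err : (eps%:E * approx_error P X 0)%E = (Num.sqrt (eps ^+ 2 * V))%:E.
  by rewrite approx_error0 sqrtrM ?sqr_ge0// sqrtr_sqr gtr0_norm.
have okS : ok (2 * #|S|).+1.
  by split; rewrite // eps_err (le_trans (approx_error_le S))// lee_fin ler_wsqrtr.
have [N okN minN] : exists2 N, ok N & forall m, ok m -> (N <= m)%N.
  have ex : exists n, `[< ok n >] by exists (2 * #|S|).+1; apply/asboolP.
  case: (ex_minnP ex) => N /asboolP okN minN; exists N => // m okm.
  by apply: minN; apply/asboolP.
set C := approx_complexity P X eps.
have [okC minC] : ok C /\ forall m, ok m -> (C <= m)%N.
  have ex : exists n, [set n | ok n /\ forall m, ok m -> (n <= m)%N] n by exists N.
  exact: (xgetPex 0%N ex).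
split; first exact: minC.
move=> u theta theta0 u0 ub; case: okC => C0; rewrite eps_err => errC.
have := le_trans (approx_error_ge C0 theta0 u0 ub) errC.
rewrite lee_fin => sq; have VV : 0 <= eps ^+ 2 * V by rewrite mulr_ge0 ?sqr_ge0.
by move: sq; rewrite ler_sqrt.
Qed.

End additive_field.

(** * Sums of regularly varying sequences *)

Section regular_sums.
Context {R : realType}.

Lemma continuous_powR (a x : R) : 0 < x -> {for x, continuous (powR (R:=R) ^~ a)}.
Proof.
move=> x0; apply: differentiable_continuous; apply/derivable1_diffP.
by have [] := is_derive1_powR a x0.
Qed.

(** Stolz-Cesaro: from some rank [N] on, a_i differs from L b_i by at most
    (e / 2) b_i, and the finitely many earlier terms are absorbed by the growth
    of the sum of the b_i. *)
Lemma stolz (a b : R^nat) (L : R) : (forall i, 0 < b i) ->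
  \sum_(i < n) b i @[n --> \oo] --> +oo -> a i / b i @[i --> \oo] --> L ->
  (\sum_(i < n) a i) / (\sum_(i < n) b i) @[n --> \oo] --> L.
Proof.
move=> b0 by_ ab; apply/cvgrPdist_le => e e0.
have e20 : 0 < e / 2 by rewrite divr_gt0.
have /cvgrPdist_le /(_ _ e20)[N _ HN] := ab.
have aN i : (N <= i)%N -> `|a i - L * b i| <= e / 2 * b i.
  move=> /HN /=; rewrite -(ler_pM2r (b0 i)) -{2}(gtr0_norm (b0 i)) -normrM.
  by rewrite mulrBl divfK ?gt_eqF// distrC.
pose C := \sum_(i < N) `|a i - L * b i|.
near=> n.
have Bn : 2 * C / e <= \sum_(i < n) b i by near: n; move/cvgryPge : by_; exact.
have B0 : 0 < \sum_(i < n) b i by near: n; move/cvgryPgt : by_; exact.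
have Nn : (N <= n)%N by near: n; exact: nbhs_infty_ge.
rewrite -[L](mulfK (lt0r_neq0 B0)) -mulrBl normrM normfV (gtr0_norm B0).
rewrite ler_pdivrMr// distrC mulr_sumr -sumrB.
apply: le_trans (ler_norm_sum _ _ _) _.
rewrite -(big_mkord xpredT (fun i => `|a i - L * b i|)) (big_cat_nat (leq0n N) Nn)/=.
rewrite big_mkord -/C; apply: (@le_trans _ _ (C + e / 2 * \sum_(i < n) b i)).
  rewrite lerD2l -(big_mkord xpredT b) [in leRHS](big_cat_nat (leq0n N) Nn)/=.
  rewrite mulrDr mulr_sumr -[leLHS]add0r lerD//.
    by apply: sumr_ge0 => i _; rewrite mulr_ge0// ltW.
  rewrite mulr_sumr; apply: ler_sum_nat => i /andP[Ni _]; exact: aN.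
move: Bn; rewrite ler_pdivrMr//; set B := \sum_(i < n) b i; lra.
Unshelve. all: by end_near.
Qed.

(** Divided by (n + 1)^p, the increment becomes 1 - (1 - 1 / (n + 1))^p; the
    claim is the derivative of x^p at 1, taken along the steps - 1 / (n + 1). *)
Lemma powR_increment_equiv (p : R) : p != 0 ->
  (n.+1%:R `^ p - n%:R `^ p) / n.+1%:R `^ (p - 1) @[n --> \oo] --> p.
Proof.
move=> p0; have [dp vp] := is_derive1_powR p (@ltr01 R).
have : (fun h : R => h^-1 *: ((h *: 1 + 1) `^ p - 1 `^ p)) h @[h --> 0^'] --> p.
  rewrite -[X in _ --> X](_ : 'D_1 (powR (R:=R) ^~ p) 1 = p) //.
  by rewrite vp powR1 mulr1.
pose u (n : nat) : R := - n.+1%:R^-1.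
have u0 : (forall n, u n != 0) /\ u n @[n --> \oo] --> (0 : R).
  split=> [n|]; first by rewrite oppr_eq0 invr_eq0 pnatr_eq0.
  by rewrite -[X in _ --> X]oppr0; apply: cvgN; exact: cvg_harmonic.
move=> /cvgr_dnbhsP /(_ u u0); apply: cvg_trans; apply: near_eq_cvg; near=> n.
have n0 : 0 < n.+1%:R :> R by [].
pose z := (n%:R / n.+1%:R : R) `^ p.
have zE : n%:R `^ p = z * n.+1%:R `^ p.
  by rewrite -powRM ?divr_ge0// divfK ?gt_eqF.
have y0 : 0 < n.+1%:R `^ p :> R by exact: powR_gt0.
have -> : u n *: 1 + 1 = n%:R / n.+1%:R :> R.
  rewrite /u /GRing.scale/= mulr1 -natr1; field.
  by rewrite natr1 pnatr_eq0.
rewrite -/z powR1 zE powRD ?pnatr_eq0 ?implybT// powR_inv1 ?ler0n//.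
rewrite /u invrN /GRing.scale/=; set y := _ `^ p in y0 *.
by field; rewrite ?gt_eqF//.
Unshelve. all: by end_near.
Qed.

Lemma cvgy_powR (p : R) : 0 < p -> n%:R `^ p @[n --> \oo] --> (+oo : set_system R).
Proof.
move=> p0; apply/cvgryPge => A; near=> n.
apply: le_trans (ler_norm A) _.
have pK : (`|A| `^ p^-1) `^ p = `|A| by rewrite -powRrM mulVf ?gt_eqF// powRr1.
rewrite -pK; apply: ge0_ler_powR; rewrite ?nnegrE ?powR_ge0//; first exact: ltW.
by near: n; exact: nbhs_infty_ger.
Unshelve. all: by end_near.
Qed.

(** The increments of n^p, p = 1 - tau, are equivalent to p n^(- tau), so [stolz]
    compares the sum of the f_j with the telescoping sum n^p. *)
Lemma regular_sum (f : R^nat) (tau L : R) : tau < 1 ->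
  f n.+1 / n.+1%:R `^ (- tau) @[n --> \oo] --> L ->
  (\sum_(i < n) f i.+1) / n%:R `^ (1 - tau) @[n --> \oo] --> L / (1 - tau).
Proof.
move=> tau1 fL; set p := 1 - tau; have p0 : 0 < p by rewrite subr_gt0.
pose b n : R := n.+1%:R `^ p - n%:R `^ p.
have sumb n : \sum_(i < n) b i = n%:R `^ p.
  rewrite -(big_mkord xpredT b) telescope_sumr// powR0 ?subr0//.
  by rewrite gt_eqF.
have b0 n : 0 < b n.
  by rewrite subr_gt0; apply: gt0_ltr_powR; rewrite ?nnegrE ?ler0n ?ltr_nat.
under eq_fun do rewrite -sumb.
apply: (@stolz (fun i => f i.+1) b _ b0).
  by under eq_fun do rewrite sumb; exact: cvgy_powR.
have h := powR_increment_equiv (lt0r_neq0 p0).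
have pE : p - 1 = - tau by rewrite /p; ring.
rewrite pE in h.
apply: cvg_trans (cvgM fL (cvgV (lt0r_neq0 p0) h)); apply: near_eq_cvg.
near=> n; rewrite /b; have w0 : 0 < n.+1%:R `^ (- tau) :> R by exact: powR_gt0.
by rewrite /= invf_div mulrA divfK ?gt_eqF.
Unshelve. all: by end_near.
Qed.

(** The sum up to m_n is about m_n^(1 - tau), and m_n / n tends to [kappa]. *)
Lemma regular_sum_at (f : R^nat) (tau L kappa : R) (m : nat -> nat) :
  tau < 1 -> 0 < kappa ->
  f n.+1 / n.+1%:R `^ (- tau) @[n --> \oo] --> L ->
  (m n)%:R / n%:R @[n --> \oo] --> kappa ->
  (\sum_(i < m n) f i.+1) / n%:R `^ (1 - tau) @[n --> \oo] -->
    L / (1 - tau) * kappa `^ (1 - tau).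
Proof.
move=> tau1 kappa0 fL mk; set p := 1 - tau; have p0 : 0 < p by rewrite subr_gt0.
have my : m n @[n --> \oo] --> \oo.
  apply/cvgnyPge => A; near=> n.
  have n0 : 0 < n%:R :> R by rewrite ltr0n; near: n; exact: nbhs_infty_gt.
  rewrite -(ler_nat R); apply: (@le_trans _ _ (kappa / 2 * n%:R)).
    rewrite mulrC -ler_pdivrMr ?divr_gt0//; near: n; exact: nbhs_infty_ger.
  rewrite -ler_pdivlMr// ltW//; near: n; apply: (cvgr_gt kappa) => //.
  by rewrite ltr_pdivrMr// mulr2n mulrDr mulr1 ltrDl.
have h1 := cvg_comp _ _ my (regular_sum tau1 fL).
have h2 : ((m n)%:R / n%:R) `^ p @[n --> \oo] --> kappa `^ p.
  exact: (cvg_comp _ _ mk (continuous_powR (a := p) kappa0)).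
apply: cvg_trans (cvgM h1 h2); apply: near_eq_cvg; near=> n.
have n0 : 0 < n%:R :> R by rewrite ltr0n; near: n; exact: nbhs_infty_gt.
have m0 : 0 < (m n)%:R :> R.
  by rewrite ltr0n; near: n; move/cvgnyPgt : my; exact.
have mp : (m n)%:R `^ p = ((m n)%:R / n%:R) `^ p * n%:R `^ p :> R.
  by rewrite -powRM ?divr_ge0// divfK ?gt_eqF.
have np0 : 0 < n%:R `^ p :> R by exact: powR_gt0.
have mp0 : 0 < ((m n)%:R / n%:R) `^ p :> R by apply: powR_gt0; exact: divr_gt0.
rewrite /= mp; field; rewrite ?gt_eqF//.
Unshelve. all: by end_near.
Qed.

End regular_sums.

(** * Asymptotics of the counting problem *)

Lemma cvg_invn {R : realType} : n%:R^-1 @[n --> \oo] --> (0 : R).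
Proof.
apply: (iffRL (gtr0_cvgV0 _) cvgr_idn); near=> n.
by rewrite ltr0n; near: n; exact: nbhs_infty_gt.
Unshelve. all: by end_near.
Qed.

Lemma cvg_truncn_ratio {R : realType} (kappa : R) : 0 <= kappa ->
  (Num.truncn (kappa * n%:R))%:R / n%:R @[n --> \oo] --> kappa.
Proof.
move=> k0.
have h : kappa - n%:R^-1 @[n --> \oo] --> kappa.
  rewrite -[X in _ --> X]subr0; apply: cvgB; first exact: cvg_cst.
  exact: cvg_invn.
apply: (@squeeze_cvgr _ _ _ _ _ _ _ _ _ h); last exact: (cvg_cst kappa).
near=> n.
have n0 : 0 < n%:R :> R by rewrite ltr0n; near: n; exact: nbhs_infty_gt.
rewrite ler_pdivrMr// ler_pdivlMr// truncn_le mulr_ge0//= andbT.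
rewrite mulrBl mulVf ?gt_eqF// lerBlDr natr1; exact/ltW/truncnS_gt.
Unshelve. all: by end_near.
Qed.

Section counting.
Context {R : realType}.
Variables alpha beta z : R^nat.
Variables c tau r eps : R.
Variable N : nat -> nat.
Hypotheses (c_gt0 : 0 < c) (tau_lt1 : tau < 1) (r_ge0 : 0 <= r) (eps_gt0 : 0 < eps).
Hypothesis beta_gt0 : forall j, (0 < j)%N -> 0 < beta j.

Local Notation w j := ((j%:R : R) `^ (- tau)).
Local Notation p := (1 - tau).
Local Notation A d := (\sum_(i < d) alpha i.+1).
Local Notation V d := (\sum_(i < d) (alpha i.+1 + 2 * beta i.+1 * z i.+1)).
(** (eps / eps_0)^2, the fraction of the sum of the beta_j that may be omitted. *)
Let q : R := eps ^+ 2 * (1 + r / 2).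

Hypothesis beta_lim : beta n.+1 / w n.+1 @[n --> \oo] --> c.
Hypothesis alpha_lim : alpha n.+1 / beta n.+1 @[n --> \oo] --> r.
Hypothesis z_lim : z n.+1 @[n --> \oo] --> (1 : R).
(** All that is used of the complexity [N d]: once a set S of coordinates brings
    the error below the tolerance, N d is at most 2 |S| + 1 and satisfies the dual
    lower bounds. *)
Hypothesis N_bounds : forall d, (0 < d)%N -> forall S : {set 'I_d},
  V d - (A d + 2 * \sum_(i in S) beta i.+1) <= eps ^+ 2 * V d ->
  (N d <= (2 * #|S|).+1)%N /\
  forall (u : 'I_d -> R) theta, 0 <= theta ->
    (forall i, 0 <= u i <= theta) -> (forall i, u i <= beta i.+1) ->
    2 * \sum_i u i - theta * (N d)%:R <= eps ^+ 2 * V d.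

Let p_gt0 : 0 < p.
Proof. by rewrite subr_gt0. Qed.

Let w_gt0 n : 0 < w n.+1.
Proof. exact: powR_gt0. Qed.

Let alpha_reg : alpha n.+1 / w n.+1 @[n --> \oo] --> r * c.
Proof.
apply: cvg_trans (cvgM alpha_lim beta_lim); apply: near_eq_cvg; near=> n.
by rewrite /= mulrA divfK// gt_eqF// beta_gt0.
Unshelve. all: by end_near.
Qed.

Let betaz_reg : (beta n.+1 * z n.+1) / w n.+1 @[n --> \oo] --> c.
Proof.
rewrite -[X in _ --> X]mulr1; apply: cvg_trans (cvgM beta_lim z_lim).
by apply: near_eq_cvg; near=> n; rewrite /= mulrAC.
Unshelve. all: by end_near.
Qed.

Let w_reg : w n.+1 / w n.+1 @[n --> \oo] --> (1 : R).
Proof.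
by under eq_fun do rewrite divff ?gt_eqF//; exact: cvg_cst.
Qed.

Let dist_reg : `|beta n.+1 - c * w n.+1| / w n.+1 @[n --> \oo] --> (0 : R).
Proof.
rewrite -[X in _ --> X](normr0 R) -[X in `|X|](subrr c).
apply: cvg_trans (cvg_norm (cvgB beta_lim (cvg_cst c))); apply: near_eq_cvg.
near=> n; rewrite /= -[in RHS](gtr0_norm (w_gt0 n)) -normfV -normrM mulrBl.
by rewrite (gtr0_norm (w_gt0 n)) mulfK// gt_eqF.
Unshelve. all: by end_near.
Qed.

Let A_lim : A d / d%:R `^ p @[d --> \oo] --> r * c / p.
Proof. exact: regular_sum alpha_reg. Qed.

Let VA_lim : (V d - A d) / d%:R `^ p @[d --> \oo] --> 2 * (c / p).
Proof.
apply: cvg_trans (cvgM (cvg_cst (2 : R)) 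
  (@regular_sum _ (fun j => beta j * z j) _ _ tau_lt1 betaz_reg)).
apply: near_eq_cvg; near=> n; rewrite big_split/= addrAC subrr add0r mulrA mulr_sumr.
by congr (_ / _); apply: eq_bigr => i _; rewrite mulrA.
Unshelve. all: by end_near.
Qed.

Let V_lim : V d / d%:R `^ p @[d --> \oo] --> (2 + r) * (c / p).
Proof.
rewrite mulrDl [r * _]mulrA; apply: cvg_trans (cvgD VA_lim A_lim).
by apply: near_eq_cvg; near=> n; rewrite /= -mulrDl subrK.
Unshelve. all: by end_near.
Qed.

Let epsV_lim : eps ^+ 2 * V d / d%:R `^ p @[d --> \oo] --> 2 * q * (c / p).
Proof.
have -> : 2 * q * (c / p) = eps ^+ 2 * ((2 + r) * (c / p)).
  by rewrite /q; field; rewrite gt_eqF.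
apply: cvg_trans (cvgM (cvg_cst (eps ^+ 2)) V_lim).
by apply: near_eq_cvg; near=> n; rewrite /= mulrA.
Unshelve. all: by end_near.
Qed.

(** Divided by d^(1 - tau), the premise of [N_bounds] tends to 2 (c / p - x) <= 2 q (c / p),
    so it holds for large d when the limit inequality is strict. *)
Let bounds_near (S : forall d, {set 'I_d}) x :
    (\sum_(i in S d) beta i.+1) / d%:R `^ p @[d --> \oo] --> x ->
    c / p - x < q * (c / p) ->
  \forall d \near \oo, (N d <= (2 * #|S d|).+1)%N /\
    forall (u : 'I_d -> R) theta, 0 <= theta ->
      (forall i, 0 <= u i <= theta) -> (forall i, u i <= beta i.+1) ->
      2 * \sum_i u i - theta * (N d)%:R <= eps ^+ 2 * V d.
Proof.
move=> Sx xq.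
have H : eps ^+ 2 * V d / d%:R `^ p - ((V d - A d) / d%:R `^ p -
    2 * ((\sum_(i in S d) beta i.+1) / d%:R `^ p)) @[d --> \oo] -->
    2 * q * (c / p) - (2 * (c / p) - 2 * x).
  exact: (cvgB epsV_lim (cvgB VA_lim (cvgM (cvg_cst (2 : R)) Sx))).
have pos : 0 < 2 * q * (c / p) - (2 * (c / p) - 2 * x) by lra.
have {pos}Hpos := cvgr_gt _ H _ pos.
near=> d.
have d0 : (0 < d)%N by near: d; exact: nbhs_infty_gt.
have dp0 : 0 < d%:R `^ p :> R by rewrite powR_gt0// ltr0n.
have Hd : 0 < eps ^+ 2 * V d / d%:R `^ p - ((V d - A d) / d%:R `^ p -
    2 * ((\sum_(i in S d) beta i.+1) / d%:R `^ p)).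
  by near: d; exact: Hpos.
apply: N_bounds => //; rewrite -subr_ge0.
move: Hd; set s := \sum_(i in S d) _; set v := V d; set a := A d => Hd.
have -> : eps ^+ 2 * v - (v - (a + 2 * s)) =
    (eps ^+ 2 * v / d%:R `^ p - ((v - a) / d%:R `^ p - 2 * (s / d%:R `^ p)))
    * d%:R `^ p by field; rewrite gt_eqF.
by rewrite mulr_ge0// ltW.
Unshelve. all: by end_near.
Qed.

Lemma N_upper (S : forall d, {set 'I_d}) (x y delta : R) :
    (\sum_(i in S d) beta i.+1) / d%:R `^ p @[d --> \oo] --> x ->
    #|S d|%:R / d%:R @[d --> \oo] --> y ->
    c / p - x < q * (c / p) -> 0 < delta ->
  \forall d \near \oo, (N d)%:R / d%:R <= 2 * y + delta.
Proof.
move=> Sx Sy xq delta0.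
have H : (2 * #|S d|).+1%:R / d%:R @[d --> \oo] --> 2 * y.
  rewrite -[X in _ --> X]addr0.
  apply: cvg_trans (cvgD (cvgM (cvg_cst (2 : R)) Sy) cvg_invn); apply: near_eq_cvg.
  by near=> d; rewrite /= -[(2 * _).+1%:R]natr1 natrM mulrDl mul1r -mulrA.
have H' : \forall d \near \oo, (2 * #|S d|).+1%:R / d%:R < 2 * y + delta.
  by apply: (cvgr_lt _ H); rewrite ltrDl.
apply: filterS2 (bounds_near Sx xq) H' => d [Nd _] /ltW; apply: le_trans.
by rewrite ler_wpM2r ?invr_ge0// ler_nat.
Unshelve. all: by end_near.
Qed.

(** [S d] consists of the indices where j^(- tau) is at least the threshold [omega d].
    Take theta = c omega(d) and u_j = min(beta_j, theta): up to the sum [D d] of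
    the errors |beta_j - c j^(- tau)|, the sum of the u_j is at least
    theta |S d| plus the sum of c j^(- tau) off S d. By the choice of x the latter
    balances the tolerance, and 2 theta |S d| <= theta N d remains, up to
    o(d^(1 - tau)). *)
Lemma N_lower (S : forall d, {set 'I_d}) (omega : R^nat) (x y y' delta : R) :
    (forall d, 0 <= omega d) ->
    (forall d i, i \in S d -> omega d <= w i.+1) ->
    (forall d i, i \notin S d -> w i.+1 <= omega d) ->
    (\sum_(i in ~: S d) w i.+1) / d%:R `^ p @[d --> \oo] --> x ->
    #|S d|%:R / d%:R @[d --> \oo] --> y ->
    omega d * d%:R / d%:R `^ p @[d --> \oo] --> y' -> 0 < y' ->
    c * x = q * (c / p) -> 0 < delta ->
  \forall d \near \oo, 2 * y - delta <= (N d)%:R / d%:R.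
Proof.
move=> omega0 Sw Scw Sx Sy om y'0 xq delta0.
pose D d := \sum_(i < d) `|beta i.+1 - c * w i.+1|.
have D_lim : D d / d%:R `^ p @[d --> \oo] --> (0 : R).
  rewrite -[X in _ --> X](mul0r p^-1).
  exact: (@regular_sum _ (fun j => `|beta j - c * w j|) _ _ tau_lt1 dist_reg).
have full_lim : (\sum_(i in [set: 'I_d]%SET) beta i.+1) / d%:R `^ p @[d --> \oo] --> c / p.
  apply: cvg_trans (regular_sum tau_lt1 beta_lim); apply: near_eq_cvg; near=> d.
  by congr (_ / _); apply: eq_bigl => i; rewrite inE.
(* the premise of [N_bounds] holds for the set of all the coordinates *)
have full_lt : c / p - c / p < q * (c / p).
  by rewrite subrr mulr_gt0 ?divr_gt0// /q mulr_gt0 ?exprn_gt0// ltr_pwDl// divr_ge0.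
(* the inequality 2 sum_i u_i - theta N d <= eps^2 V d, solved for N d / d and
   written in terms of quotients whose limits are known *)
pose lb d := (2 * (c * (#|S d|%:R / d%:R * (omega d * d%:R / d%:R `^ p)) +
    c * ((\sum_(i in ~: S d) w i.+1) / d%:R `^ p) - D d / d%:R `^ p) -
    eps ^+ 2 * V d / d%:R `^ p) / (c * (omega d * d%:R / d%:R `^ p)).
have lb_lim : lb d @[d --> \oo] --> 2 * y.
  have -> : 2 * y = (2 * (c * (y * y') + c * x - 0) - 2 * q * (c / p)) / (c * y').
    by rewrite xq; field; rewrite !gt_eqF.
  apply: cvgM; last first.
    apply: cvgV; first by rewrite mulf_neq0 ?gt_eqF.
    by apply: cvgM om; exact: cvg_cst.
  apply: cvgB epsV_lim; apply: cvgM; first exact: cvg_cst.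
  apply: cvgB D_lim; apply: cvgD.
    by apply: cvgM (cvgM Sy om); exact: cvg_cst.
  by apply: cvgM Sx; exact: cvg_cst.
have lb_near : \forall d \near \oo, 2 * y - delta < lb d.
  by apply: (cvgr_gt _ lb_lim); rewrite ltrBlDr ltrDl.
have om_near : \forall d \near \oo, 0 < omega d * d%:R / d%:R `^ p.
  exact: (cvgr_gt _ om).
have d_near : \forall d \near \oo, (0 < d)%N by exact: nbhs_infty_gt.
apply: filterS3 (filterI d_near om_near) lb_near (bounds_near full_lim full_lt).
move=> d [d0 om0] /ltW lb_d [_ low]; apply: le_trans lb_d _.
have dr0 : 0 < d%:R :> R by rewrite ltr0n.
have dp0 : 0 < d%:R `^ p :> R by rewrite powR_gt0.
have omd : 0 < omega d by move: om0; rewrite pmulr_lgt0 ?invr_gt0// pmulr_lgt0.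
pose u (i : 'I_d) := Num.min (beta i.+1) (c * omega d).
have u0 i : 0 <= u i <= c * omega d.
  rewrite le_min ge_min lexx orbT andbT (ltW (beta_gt0 _))//=.
  by rewrite mulr_ge0 ?ltW.
have ub i : u i <= beta i.+1 by rewrite ge_min lexx.
have {low} := low u _ (mulr_ge0 (ltW c_gt0) (omega0 d)) u0 ub.
have : c * (#|S d|%:R * omega d) + c * \sum_(i in ~: S d) w i.+1 - D d <=
    \sum_i u i.
  have -> : #|S d|%:R * omega d = \sum_(i in S d) omega d.
    by rewrite sumr_const mulr_natl.
  rewrite -mulrDr lerBlDr.
  pose v (i : 'I_d) := if i \in S d then omega d else w i.+1.
  rewrite (_ : _ + _ = \sum_i v i); last first.
    rewrite [RHS](bigID (mem (S d)))/=; congr (_ + _).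
      by apply: eq_bigr => i iS; rewrite /v iS.
    apply: eq_big => [i|i]; first by rewrite inE.
    by rewrite inE /v => /negbTE ->.
  rewrite mulr_sumr -big_split/=; apply: ler_sum => i _.
  have vw : v i <= w i.+1 by rewrite /v; case: ifPn => // /Sw.
  have vo : v i <= omega d by rewrite /v; case: ifPn => // /Scw.
  have {}vw := ler_wpM2l (ltW c_gt0) vw.
  have {}vo := ler_wpM2l (ltW c_gt0) vo.
  rewrite /u minEle; case: ifP => _; last by apply: le_trans vo _; rewrite lerDl.
  apply: le_trans vw _; rewrite -lerBlDl; apply: le_trans (ler_norm _) _.
  by rewrite distrC.
set U := \sum_i u i; set W := \sum_(i in ~: S d) _; set v := V d.
move=> Uge low.
have -> : lb d = (2 * (c * (#|S d|%:R * omega d) + c * W - D d) - eps ^+ 2 * v)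
    / (c * omega d) / d%:R.
  by rewrite /lb -/W -/v; field; rewrite !gt_eqF.
rewrite ler_wpM2r ?invr_ge0// ler_pdivrMr ?mulr_gt0// [leRHS]mulrC.
lra.
Unshelve. all: by end_near.
Qed.

Local Notation head m := (fun d => [set i : 'I_d | (i < m d)%N]%SET).

Let trunc_mul (kappa : R) d := Num.truncn (kappa * d%:R).

Let trunc_mul_le kappa d : 0 <= kappa < 1 -> (trunc_mul kappa d <= d)%N.
Proof.
move=> /andP[k0 k1]; rewrite -(ler_nat R); apply: (@le_trans _ _ (kappa * d%:R)).
  by rewrite truncn_le mulr_ge0.
by rewrite ler_piMl// ltW.
Qed.

Let sum_head (W : nmodType) (f : nat -> W) d m : (m <= d)%N ->
  \sum_(i in [set i : 'I_d | (i < m)%N]%SET) f i = \sum_(i < m) f i.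
Proof.
by move=> md; rewrite (big_ord_widen d f md); apply: eq_bigl => i; rewrite inE.
Qed.

Let card_head d m : (m <= d)%N -> #|[set i : 'I_d | (i < m)%N]%SET| = m.
Proof.
move=> md; rewrite -sum1_card; apply: etrans (sum_head (W := nat) (fun=> 1%N) md) _.
by rewrite sum1_card card_ord.
Qed.

Let sum_tail (f : nat -> R) d m : (m <= d)%N ->
  \sum_(i in ~: [set i : 'I_d | (i < m)%N]%SET) f i =
  \sum_(i < d) f i - \sum_(i < m) f i.
Proof.
move=> md; rewrite -(sum_head f md) [in RHS](bigID (mem [set i : 'I_d | (i < m)%N]%SET))/=.
by rewrite addrAC subrr add0r; apply: eq_bigl => i; rewrite inE.
Qed.

Section at_ratio.
Variable kappa : R.
Hypothesis kappa01 : 0 < kappa < 1.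
Let m := trunc_mul kappa.

Let kappa_gt0 : 0 < kappa. Proof. by case/andP: kappa01. Qed.

Let m_le d : (m d <= d)%N.
Proof. by apply: trunc_mul_le; case/andP: kappa01 => /ltW -> ->. Qed.

Let m_lim : (m d)%:R / d%:R @[d --> \oo] --> kappa.
Proof. exact/cvg_truncn_ratio/ltW. Qed.

Lemma head_sum_lim (f : R^nat) (L : R) : f n.+1 / w n.+1 @[n --> \oo] --> L ->
  (\sum_(i in head m d) f i.+1) / d%:R `^ p @[d --> \oo] --> L / p * kappa `^ p.
Proof.
move=> fL; under eq_fun do rewrite (sum_head (fun i => f i.+1) (m_le _)).
exact: regular_sum_at fL m_lim.
Qed.

Lemma tail_sum_lim (f : R^nat) (L : R) : f n.+1 / w n.+1 @[n --> \oo] --> L ->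
  (\sum_(i in ~: head m d) f i.+1) / d%:R `^ p @[d --> \oo] -->
  L / p - L / p * kappa `^ p.
Proof.
move=> fL; under eq_fun do rewrite (sum_tail (fun i => f i.+1) (m_le _)) mulrBl.
apply: cvgB; first exact: regular_sum.
exact: regular_sum_at fL m_lim.
Qed.

Lemma head_card_lim : #|head m d|%:R / d%:R @[d --> \oo] --> kappa.
Proof. by under eq_fun do rewrite card_head//; exact: m_lim. Qed.

Lemma tail_card_lim : #|~: head m d|%:R / d%:R @[d --> \oo] --> 1 - kappa.
Proof.
apply: cvg_trans (cvgB (cvg_cst (1 : R)) m_lim); apply: near_eq_cvg; near=> d.
have d0 : d%:R != 0 :> R by rewrite pnatr_eq0 -lt0n; near: d; exact: nbhs_infty_gt.
rewrite /= cardsCs finset.setCK card_ord card_head// natrB// mulrBl divff//.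
Unshelve. all: by end_near.
Qed.

(** The threshold omega(d) = (m + 1)^(- tau) suits the head {j <= m}, which collects the
    large values of j^(- tau) if tau >= 0, and the tail {j > m}, which collects
    them if tau < 0. *)
Lemma threshold_lim :
  w (m d).+1 * d%:R / d%:R `^ p @[d --> \oo] --> kappa `^ (- tau).
Proof.
have h : (m d).+1%:R / d%:R @[d --> \oo] --> kappa.
  rewrite -[X in _ --> X]addr0; apply: cvg_trans (cvgD m_lim cvg_invn).
  by apply: near_eq_cvg; near=> d; rewrite -natr1 mulrDl mul1r.
apply: cvg_trans (cvg_comp _ _ h (continuous_powR (a := - tau) kappa_gt0)).
apply: near_eq_cvg; near=> d.
have d0 : 0 < d%:R :> R by rewrite ltr0n; near: d; exact: nbhs_infty_gt.
have wm : w (m d).+1 = ((m d).+1%:R / d%:R) `^ (- tau) * d%:R `^ (- tau).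
  by rewrite -powRM ?divr_ge0// divfK ?gt_eqF.
have dp : d%:R `^ p = d%:R * d%:R `^ (- tau) :> R.
  by rewrite powRD ?gt_eqF ?implybT// powRr1.
have dw0 : 0 < d%:R `^ (- tau) :> R by exact: powR_gt0.
by rewrite /= wm dp; field; rewrite !gt_eqF.
Unshelve. all: by end_near.
Qed.

End at_ratio.

Hypothesis q_lt1 : q < 1.

Let q_gt0 : 0 < q.
Proof. by rewrite mulr_gt0 ?exprn_gt0// ltr_pwDl// divr_ge0. Qed.

Let cvg_of_bounds (f : R^nat) l :
    (forall delta, 0 < delta -> \forall d \near \oo, f d <= l + delta) ->
    (forall delta, 0 < delta -> \forall d \near \oo, l - delta <= f d) ->
  f d @[d --> \oo] --> l.
Proof.
move=> up lo; apply/cvgrPdist_le => e e0.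
apply: filterS2 (up _ e0) (lo _ e0) => d u v.
by rewrite ler_norml; lra.
Qed.

Let between (k k' e : R) : k < k' -> 0 < e -> exists2 x, k < x < k' & x <= k + e.
Proof.
move=> kk e0; exists (Num.min ((k + k') / 2) (k + e)).
  by rewrite lt_min gt_min; apply/andP; split; [apply/andP; split|apply/orP; left]; lra.
by rewrite ge_min lexx orbT.
Qed.

Let powR_lt (x y : R) : 0 <= x -> x < y -> x `^ p < y `^ p.
Proof.
by move=> x0 xy; apply: gt0_ltr_powR => //; rewrite nnegrE// (le_trans x0)// ltW.
Qed.

Let root_pow (x : R) : 0 < x < 1 -> (x `^ p^-1) `^ p = x /\ 0 < x `^ p^-1 < 1.
Proof.
move=> /andP[x0 x1]; have xp : (x `^ p^-1) `^ p = x.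
  by rewrite -powRrM mulVf ?gt_eqF// powRr1// ltW.
split=> //; rewrite powR_gt0//=.
apply: (@lt_le_trans _ _ (1 `^ p^-1)); last by rewrite powR1.
by apply: gt0_ltr_powR; rewrite ?nnegrE ?invr_gt0 ?ltW.
Qed.

(** Split the coordinates at k d with k^(1 - tau) = 1 - q, so that the tail beyond k d
    carries the fraction q of the sum. The upper bound keeps the coordinates up
    to x d with x slightly larger than k, which makes the inequality of
    [bounds_near] strict; the lower bound uses k itself. *)
Lemma N_ratio_nonneg : 0 <= tau ->
  (N d)%:R / d%:R @[d --> \oo] --> 2 * (1 - q) `^ p^-1.
Proof.
move=> tau0; set k := _ `^ _.
have [kp /andP[k0 k1]] : k `^ p = 1 - q /\ 0 < k < 1.
  by apply: root_pow; rewrite subr_gt0 q_lt1 gtrBl q_gt0.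
have cp0 : 0 < c / p by rewrite divr_gt0.
apply: cvg_of_bounds => delta delta0.
  have d4 : 0 < delta / 4 by lra.
  have [x /andP[kx x1] xd] := between k1 d4.
  have x01 : 0 < x < 1 by rewrite x1 (lt_trans k0 kx).
  have d2 : 0 < delta / 2 by lra.
  have := N_upper (head_sum_lim x01 beta_lim) (head_card_lim x01) _ d2.
  have xp : 1 - q < x `^ p by rewrite -kp powR_lt// ltW.
  have lt : c / p - c / p * x `^ p < q * (c / p).
    by rewrite -{1}[c / p]mulr1 -mulrBr mulrC ltr_pM2r// ltrBlDr -ltrBlDl.
  by move=> /(_ lt); apply: filterS => d; lra.
have k01 : 0 < k < 1 by rewrite k0.
have tail_lim := @tail_sum_lim _ k01 (fun j => w j) _ w_reg.
apply: (N_lower (omega := fun d => w (trunc_mul k d).+1) _ _ _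
  tail_lim (head_card_lim k01) (threshold_lim k01)) => //.
- move=> d i; rewrite inE => im.
  rewrite !powRN lef_pV2 ?posrE ?powR_gt0//.
  by apply: ge0_ler_powR; rewrite ?nnegrE// ler_nat ltnS ltnW.
- move=> d i; rewrite inE -leqNgt => im.
  rewrite !powRN lef_pV2 ?posrE ?powR_gt0//.
  by apply: ge0_ler_powR; rewrite ?nnegrE// ler_nat ltnS.
- exact: powR_gt0.
by rewrite kp; field; rewrite gt_eqF.
Qed.

(** Here the head carries the small values: k^(1 - tau) = q, and the tail
    beyond k d is kept. *)
Lemma N_ratio_neg : tau < 0 ->
  (N d)%:R / d%:R @[d --> \oo] --> 2 * (1 - q `^ p^-1).
Proof.
move=> tau0; set k := _ `^ _.
have [kp /andP[k0 k1]] : k `^ p = q /\ 0 < k < 1.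
  by apply: root_pow; apply/andP; split.
have cp0 : 0 < c / p by rewrite divr_gt0.
apply: cvg_of_bounds => delta delta0.
  have d4 : 0 < delta / 4 by lra.
  (* x slightly smaller than k, by symmetry from [between] *)
  have kN : - k < 0 by lra.
  have [y /andP[ky y0] yd] := between kN d4.
  pose x := - y; have x01 : 0 < x < 1 by rewrite /x; lra.
  have d2 : 0 < delta / 2 by lra.
  have := N_upper (tail_sum_lim x01 beta_lim) (tail_card_lim x01) _ d2.
  have xp : x `^ p < q by rewrite -kp powR_lt// /x; lra.
  have lt : c / p - (c / p - c / p * x `^ p) < q * (c / p).
    by rewrite opprB addrC subrK mulrC ltr_pM2r.
  by move=> /(_ lt); apply: filterS => d; rewrite /x; lra.
have k01 : 0 < k < 1 by rewrite k0.
have head_lim := @head_sum_lim _ k01 (fun j => w j) _ w_reg.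
apply: (N_lower (omega := fun d => w (trunc_mul k d).+1)
  (S := fun d => ~: [set i : 'I_d | (i < trunc_mul k d)%N]%SET) _ _ _
  _ (tail_card_lim k01) (threshold_lim k01)) => //.
- move=> d i; rewrite !inE -leqNgt => im.
  by apply: ge0_ler_powR; rewrite ?nnegrE// ?ler_nat ?ltnS//; lra.
- move=> d i; rewrite !inE negbK => im.
  by apply: ge0_ler_powR; rewrite ?nnegrE// ?ler_nat ?ltnS 1?ltnW//; lra.
- by under eq_fun do rewrite finset.setCK; exact: head_lim.
- exact: powR_gt0.
by rewrite kp; field; rewrite gt_eqF.
Qed.

End counting.

(** * The complexity of additive Korobov fields *)

Lemma eps0_ratio {R : realType} (r eps : R) : 0 <= r ->
  (eps / eps0 r) ^+ 2 = eps ^+ 2 * (1 + r / 2).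
Proof.
move=> r0; have r1 : 0 < 1 + r / 2 by rewrite ltr_pwDl// divr_ge0.
rewrite expr_div_n; congr (_ * _); rewrite /eps0 -powR_mulrn ?powR_ge0//.
by rewrite -powRrM mulNr mulVf// powR_inv1 ?invrK// ltW.
Qed.

Theorem theorem4 (R : realType)
  (alpha beta sigma : R^nat) (c tau r : R)
  (halpha : forall j, (0 < j)%N -> 0 < alpha j)
  (hbeta : forall j, (0 < j)%N -> 0 < beta j)
  (hsigma : forall j, (0 < j)%N -> 1 < sigma j)
  (* the processes B_j on [0,1] *)
  (dispB : nat -> measure_display)
  (OmegaB : forall j, measurableType (dispB j))
  (PB : forall j, probability (OmegaB j) R)
  (B : forall j, R -> OmegaB j -> R)
  (hB0 : forall j, (0 < j)%N -> zero_mean_process (PB j) `[0, 1] (B j))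
  (hBK : forall j, (0 < j)%N ->
    has_covariance_function (PB j) `[0, 1] (B j)
      (fun t s => (korobov (alpha j) (beta j) (sigma j) t s)%:E))
  (* the associated additive random fields on [0,1]^d *)
  (disp : nat -> measure_display)
  (Omega : forall d, measurableType (disp d))
  (P : forall d, probability (Omega d) R)
  (BB : forall d, d.-tuple (measurableTypeR R) -> Omega d -> R)
  (hBB0 : forall d, (0 < d)%N -> zero_mean_random_field (P d) (BB d))
  (hBBK : forall d, (0 < d)%N ->
    has_covariance_function (P d) (cube d) (BB d)
      (additive_covariance
         (fun j t s => covariance (PB j) (B j t) (B j s)) (d := d)))
  (hc : 0 < c) (htau : tau < 1) (hr : 0 <= r)
  (hbeta_lim : asymp_equiv beta (fun j => c * j%:R `^ (- tau)))
  (halpha_lim : (alpha j / beta j) @[j --> \oo] --> r)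
  (hsigma_lim : sigma j @[j --> \oo] --> +oo) :
  forall eps : R, 0 < eps < eps0 r ->
    asymp_equiv (fun d => (approx_complexity (P d) (BB d) eps)%:R)
                (fun d => 2 * Q r tau eps * d%:R).
Proof.
move=> eps /andP[eps_gt0 eps_lt].
have e0 : 0 < eps0 r by rewrite powR_gt0// ltr_pwDl// divr_ge0.
have ratio_gt0 : 0 < eps / eps0 r by rewrite divr_gt0.
have qE := eps0_ratio eps hr.
have q_lt1 : eps ^+ 2 * (1 + r / 2) < 1.
  by rewrite -qE expr_lt1 ?ltW// ltr_pdivrMr// mul1r.
pose N d := approx_complexity (P d) (BB d) eps.
have beta_lim : beta n.+1 / n.+1%:R `^ (- tau) @[n --> \oo] --> c.
  have := hbeta_lim; rewrite /asymp_equiv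
    -(cvg_shiftS (fun n => beta n / (c * n%:R `^ (- tau)))) => bl.
  rewrite -[X in _ --> X]mul1r; apply: cvg_trans (cvgM bl (cvg_cst c)).
  apply: near_eq_cvg; near=> n.
  have w0 : 0 < n.+1%:R `^ (- tau) :> R by exact: powR_gt0.
  by rewrite /=; field; rewrite !gt_eqF.
have alpha_lim : alpha n.+1 / beta n.+1 @[n --> \oo] --> r.
  by rewrite (cvg_shiftS (fun n => alpha n / beta n)).
have z_lim : zeta (sigma n.+1) @[n --> \oo] --> (1 : R).
  by rewrite (cvg_shiftS (fun n => zeta (sigma n))); exact: zeta_cvg1.
have N_bounds d : (0 < d)%N -> forall S : {set 'I_d},
    let V := \sum_(i < d) (alpha i.+1 + 2 * beta i.+1 * zeta (sigma i.+1)) in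
    V - (\sum_(i < d) alpha i.+1 + 2 * \sum_(i in S) beta i.+1) <= eps ^+ 2 * V ->
    (N d <= (2 * #|S|).+1)%N /\
    forall (u : 'I_d -> R) theta, 0 <= theta ->
      (forall i, 0 <= u i <= theta) -> (forall i, u i <= beta i.+1) ->
      2 * \sum_i u i - theta * (N d)%:R <= eps ^+ 2 * V.
  move=> d0 S V.
  apply: (complexity_bounds (alpha := fun i : 'I_d => alpha i.+1)
    (beta := fun i => beta i.+1) (sigma := fun i => sigma i.+1)) => //.
  - by move=> i; exact: halpha.
  - by move=> i; exact: hbeta.
  - by move=> i; exact: hsigma.
  - exact: hBB0.
  move=> t s tc sc; rewrite (hBBK _ d0 _ _ tc sc) /additive_covariance -sumEFin.
  by apply: eq_bigr => i _; apply: hBK => //=.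
have N_lim : (N d)%:R / d%:R @[d --> \oo] --> 2 * Q r tau eps.
  rewrite /Q; case: ifPn => [tau0|].
    rewrite qE.
    exact: (N_ratio_nonneg (z := fun j => zeta (sigma j)) hc htau hr eps_gt0
      hbeta beta_lim alpha_lim z_lim N_bounds q_lt1 tau0).
  rewrite -ltNge => tau0.
  have -> : (eps / eps0 r) `^ (2 / (1 - tau)) =
      (eps ^+ 2 * (1 + r / 2)) `^ (1 - tau)^-1.
    by rewrite powRrM powR_mulrn ?ltW// qE.
  exact: (N_ratio_neg (z := fun j => zeta (sigma j)) hc htau hr eps_gt0
    hbeta beta_lim alpha_lim z_lim N_bounds q_lt1 tau0).
have Q0 : 0 < Q r tau eps.
  rewrite /Q qE; case: ifPn => _; first by apply: powR_gt0; rewrite subr_gt0.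
  rewrite subr_gt0; apply: (@lt_le_trans _ _ (1 `^ (2 / (1 - tau)))); last by rewrite powR1.
  apply: gt0_ltr_powR; rewrite ?nnegrE ?ltW ?divr_gt0 ?subr_gt0//.
  by rewrite ltr_pdivrMr// mul1r.
have Q20 : 2 * Q r tau eps != 0 by rewrite mulf_neq0// gt_eqF.
rewrite /asymp_equiv -[X in _ --> X](divff Q20).
apply: cvg_trans (cvgM N_lim (cvg_cst (2 * Q r tau eps)^-1)).
apply: near_eq_cvg; near=> d.
by set y := 2 * Q r tau eps; rewrite [in RHS]invfM [y^-1 * _]mulrC mulrA.
Unshelve. all: by end_near.
Qed.
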